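(* Let $G$ be a discrete group of reflections in a polygon $Q\subset\mathbb{H}^2$. Then $G$ contains an index $2$ subgroup of orientation-preserving isometries which admits a Double Dirichlet domain, and which also admits a DF domain if $Q$ has an ideal vertex at $\infty$.
   Context: $\mathbb{H}^2$ is the upper half-plane with hyperbolic distance $d$; orientation-preserving isometries are identified with $\mathrm{PSL}_2(\mathbb{R})$. A Fuchsian group is a discrete subgroup $\Gamma<\mathrm{PSL}_2(\mathbb{R})$. A fundamental domain for $\Gamma$ is a closed convex polygon whose $\Gamma$-translates cover $\mathbb{H}^2$ and whose interior is disjoint from its translates by nontrivial elements of $\Gamma$. Polygons are convex, finite-sided and of finite area (ideal vertices, with angle $0$, are allowed). A discrete group of reflections in a polygon $Q$ (discrete reflection group with respect to $Q$) is the group generated by the reflections of $\mathbb{H}^2$ in the sides of $Q$, where this group is discrete and the translates $gQ$, $g\in G$, tessellate $\mathbb{H}^2$; the angles of $Q$ are then each $0$ or $\pi/k$ for an integer $k\ge2$. Dirichlet domain of a Fuchsian group $\Gamma$ centered at $z_0\in\mathbb{H}^2$: the set $\{x\in\mathbb{H}^2 : d(x,z_0)\le d(x,\alpha(z_0))\ \forall\, 1\ne\alpha\in\Gamma\}$. Ford domain: suppose $\infty$ is a parabolic fixed point of $\Gamma$, with stabilizer $\Gamma_\infty<\Gamma$. For $\gamma=\pm\begin{pmatrix}a&b\\c&d\end{pmatrix}\in\Gamma\setminus\Gamma_\infty$, the isometric circle is $S_\gamma=\{z:|cz+d|=1\}$. A Ford domain is the intersection of the set of points of $\mathbb{H}^2$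 lying on or outside all isometric circles $S_\gamma$, $\gamma\in\Gamma\setminus\Gamma_\infty$, with a fundamental domain for the action of $\Gamma_\infty$ that is a vertical strip $\{x_0\le \mathrm{Re}(z)\le x_0+t\}$ (where $z\mapsto z+t$, $t>0$, generates $\Gamma_\infty$). A DF domain for $\Gamma$ is a fundamental domain for $\Gamma$ which is both a Ford domain and a Dirichlet domain for some center $z_0\in\mathbb{H}^2$. A Double Dirichlet domain for $\Gamma$ is a fundamental domain for $\Gamma$ which is the Dirichlet domain centered at $z_0$ and also the Dirichlet domain centered at $z_1$, for some $z_0\neq z_1$ in $\mathbb{H}^2$. *)

(* Defs.v *)
From HB Require Import structures.
From mathcomp Require Import all_boot all_order all_algebra.
From mathcomp Require Import complex.
From mathcomp Require Import all_classical all_reals all_analysis.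

Set Implicit Arguments.
Unset Strict Implicit.
Unset Printing Implicit Defensive.

Import Order.TTheory GRing.Theory Num.Theory.
Import numFieldNormedType.Exports.

Local Open Scope classical_set_scope.
Local Open Scope ring_scope.
Local Open Scope complex_scope.
Local Open Scope card_scope.

Record uhp (R : realType) := Uhp {
  uval :> R[i];
  uval_Im_gt0 : 0 < complex.Im uval }.

HB.instance Definition _ (R : realType) := [isSub for @uval R].
HB.instance Definition _ (R : realType) := [Choice of uhp R by <:].

Definition ucoord (R : realType) (z : uhp R) : R * R :=
  (complex.Re z, complex.Im z).

(* The hyperbolic metric induces the Euclidean subspace topology. *)
HB.instance Definition _ (R : realType) :=
  Topological.copy (uhp R) (initial_topology (@ucoord R)).

(* arcosh (1 + |z - w|^2 / (2 Im z Im w)), with arcosh u = ln (u + sqrt (u^2 - 1)) *)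
Definition hdist (R : realType) (z w : uhp R) : R :=
  let u := 1 + ((complex.Re z - complex.Re w) ^+ 2 +
                (complex.Im z - complex.Im w) ^+ 2) /
               (2 * complex.Im z * complex.Im w) in
  ln (u + Num.sqrt (u ^+ 2 - 1)).

Definition harea (R : realType) (S : set (uhp R)) : \bar R :=
  (\int[(@lebesgue_measure R) \x (@lebesgue_measure R)]_(p in @ucoord R @` S)
     (p.2 ^- 2)%:E)%E.

(* The geodesics are the vertical half-lines Re z = x and the half-circles
   |z - x| = r. *)
Variant geodesic (R : realType) :=
  | Vertical of R
  | HalfCircle of R & {posnum R}.

Definition geodesic_eqn (R : realType) (L : geodesic R) (z : uhp R) : R :=
  match L with
  | Vertical x => complex.Re z - x
  | HalfCircle x r =>
      (complex.Re z - x) ^+ 2 + complex.Im z ^+ 2 - r%:num ^+ 2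
  end.

Definition line (R : realType) (L : geodesic R) : set (uhp R) :=
  [set z | geodesic_eqn L z = 0].

Definition side_pos (R : realType) (L : geodesic R) : set (uhp R) :=
  [set z | 0 <= geodesic_eqn L z].

Definition side_neg (R : realType) (L : geodesic R) : set (uhp R) :=
  [set z | geodesic_eqn L z <= 0].

Definition half_plane (R : realType) (S : set (uhp R)) : Prop :=
  exists L : geodesic R, S = side_pos L \/ S = side_neg L.

Definition polygon (R : realType) (Q : set (uhp R)) : Prop :=
  [/\ exists (n : nat) (S : 'I_n -> set (uhp R)),
        (forall i, half_plane (S i)) /\ Q = \bigcap_i S i,
      Q° !=set0
    & (harea Q < +oo)%E].

Definition bears_side (R : realType) (Q : set (uhp R)) (L : geodesic R) : Prop :=
  (Q `<=` side_pos L \/ Q `<=` side_neg L) /\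
  exists z w, [/\ (Q `&` line L) z, (Q `&` line L) w & z <> w].

Definition ideal_vertex_at_infty (R : realType) (Q : set (uhp R)) : Prop :=
  exists x y : R, x <> y /\
    forall t, t = x \/ t = y ->
      bears_side Q (Vertical t) /\
      forall M : R, exists2 z, (Q `&` line (Vertical t)) z & M < complex.Im z.

Definition reflection_in (R : realType) (L : geodesic R)
    (f : uhp R -> uhp R) : Prop :=
  forall z : uhp R, uval (f z) =
    match L with
    | Vertical x => (2 * x)%:C - (uval z)^*
    | HalfCircle x r => x%:C + (r%:num ^+ 2)%:C / ((uval z)^* - x%:C)
    end.

Definition is_group (T : Type) (G : set (T -> T)) : Prop :=
  [/\ G id,
      forall f g, G f -> G g -> G (f \o g)
    & forall f, G f -> exists2 g, G g & f \o g = id /\ g \o f = id].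

Definition generated (T : Type) (S : set (T -> T)) : set (T -> T) :=
  smallest (@is_group T) S.

Definition index_two_subgroup (T : Type) (H G : set (T -> T)) : Prop :=
  [/\ is_group H, is_group G, H `<=` G
    & [set [set g \o h | h in H] | g in G] #= `I_2].

Definition preserving_matrix (R : realType) (A : 'M[R]_2)
    (f : uhp R -> uhp R) : Prop :=
  \det A = 1 /\ forall z : uhp R,
    uval (f z) = ((A 0 0)%:C * uval z + (A 0 1)%:C) /
                 ((A 1 0)%:C * uval z + (A 1 1)%:C).

Definition reversing_matrix (R : realType) (A : 'M[R]_2)
    (f : uhp R -> uhp R) : Prop :=
  \det A = -1 /\ forall z : uhp R,
    uval (f z) = ((A 0 0)%:C * (uval z)^* + (A 0 1)%:C) /
                 ((A 1 0)%:C * (uval z)^* + (A 1 1)%:C).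

Definition orientation_preserving (R : realType) (f : uhp R -> uhp R) : Prop :=
  exists A : 'M[R]_2, preserving_matrix A f.

Definition matrix_lifts (R : realType) (G : set (uhp R -> uhp R)) :
    set 'M[R]_2 :=
  [set A | exists2 f, G f & preserving_matrix A f \/ reversing_matrix A f].

(* The isometry group of the upper half-plane carries the quotient topology of
   {A | det A = 1 or det A = -1} by {1, -1}; a subgroup is discrete exactly when
   its preimage is a discrete set of matrices. *)
Definition discrete_isometries (R : realType) (G : set (uhp R -> uhp R)) : Prop :=
  matrix_lifts G `<=` isolated (matrix_lifts G).

Definition fuchsian (R : realType) (G : set (uhp R -> uhp R)) : Prop :=
  [/\ is_group G, G `<=` @orientation_preserving R & discrete_isometries G].

Definition covers (R : realType) (G : set (uhp R -> uhp R))
    (P : set (uhp R)) : Prop :=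
  \bigcup_(g in G) (g @` P) = setT.

Definition fundamental_domain (R : realType) (G : set (uhp R -> uhp R))
    (P : set (uhp R)) : Prop :=
  [/\ polygon P, covers G P
    & forall g, G g -> g <> id -> P° `&` (g @` P°) = set0].

(* Tiles are indexed by group elements: distinct g, h in G give tiles gQ and hQ
   with disjoint interiors. *)
Definition tessellates (R : realType) (G : set (uhp R -> uhp R))
    (Q : set (uhp R)) : Prop :=
  covers G Q /\
  forall g h, G g -> G h -> g <> h -> (g @` Q)° `&` (h @` Q)° = set0.

Definition discrete_reflection_group (R : realType) (Q : set (uhp R))
    (G : set (uhp R -> uhp R)) : Prop :=
  [/\ polygon Q,
      G = generated [set f | exists2 L, bears_side Q L & reflection_in L f],
      discrete_isometries G
    & tessellates G Q].

Definition dirichlet_domain (R : realType) (G : set (uhp R -> uhp R))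
    (z0 : uhp R) : set (uhp R) :=
  [set x | forall a, G a -> a <> id -> hdist x z0 <= hdist x (a z0)].

Definition stab_infty (R : realType) (G : set (uhp R -> uhp R)) :
    set (uhp R -> uhp R) :=
  [set f | G f /\ exists2 A, preserving_matrix A f & A 1 0 = 0].

Definition outside_isometric_circles (R : realType)
    (G : set (uhp R -> uhp R)) : set (uhp R) :=
  [set z | forall A f, G f -> ~ stab_infty G f -> preserving_matrix A f ->
     1 <= `|(A 1 0)%:C * uval z + (A 1 1)%:C|].

(* A generator z |-> z + t of the stabilizer with t > 0 is a parabolic element
   fixing infinity, so infinity is a parabolic fixed point of G. *)
Definition ford_domain (R : realType) (G : set (uhp R -> uhp R))
    (P : set (uhp R)) : Prop :=
  exists (x0 t : R) (tau : uhp R -> uhp R),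
    [/\ 0 < t,
        forall z, uval (tau z) = uval z + t%:C,
        stab_infty G = generated [set tau]
      & P = outside_isometric_circles G `&`
            [set z | x0 <= complex.Re z <= x0 + t]].

Definition DF_domain (R : realType) (G : set (uhp R -> uhp R))
    (P : set (uhp R)) : Prop :=
  [/\ fundamental_domain G P, ford_domain G P
    & exists z0, P = dirichlet_domain G z0].

Definition double_dirichlet_domain (R : realType) (G : set (uhp R -> uhp R))
    (P : set (uhp R)) : Prop :=
  fundamental_domain G P /\
  exists z0 z1,
    [/\ z0 <> z1, P = dirichlet_domain G z0 & P = dirichlet_domain G z1].

(* Main.v *)
Require Import Defs.
From mathcomp Require Import all_boot all_order all_algebra.
From mathcomp Require Import complex ring lra.
From mathcomp Require Import all_classical all_reals all_analysis.
From mathcomp Require Import measurable_realfun.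
From mathcomp Require finmap.

(** Let [rotations G] be the orientation-preserving elements of [G], let [L] be a
    side line of [Q] with reflection [s], and let [P] be the union of [Q] and [s Q].
    If [x] and [z] lie in [Q], then no point of the orbit [G z] is closer to [x] than
    [z]: for interior [x] and [z] the orbit is uniformly discrete, so some [g z] is
    closest to [x]; comparing it with its mirror images in the sides puts [g z] in [Q],
    and the tessellation forces [g = id].  Hence, when [z] lies on [L] strictly inside
    the other sides, [P] is the Dirichlet domain of [rotations G] centred at [z], because
    [s] fixes [z]; any two such points of a side give a double Dirichlet domain.

    In the coordinates [(Re z, |z|^2)] half-planes are affine, which makes convexity
    arguments elementary.  The area of [s Q] is controlled without a change of variables:
    a finite intersection of half-planes has finite area exactly when it contains no
    half-plane, and this criterion is invariant under isometries.

    If [Q] has an ideal vertex at infinity, take [L] vertical and let [z] tend to infinity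
    along [L]: the Dirichlet inequalities become [Im (g w) <= Im w], which is the condition
    defining the exterior of the isometric circles. *)

Set Implicit Arguments.
Unset Strict Implicit.
Unset Printing Implicit Defensive.

Import Order.TTheory GRing.Theory Num.Theory.
Import numFieldNormedType.Exports.

Local Open Scope classical_set_scope.
Local Open Scope ring_scope.
Local Open Scope complex_scope.
Local Open Scope card_scope.

(** The difficulty is that [doubled] must be shown convex although nothing is assumed about the
    angles of [Q]. The Dirichlet inequalities settle this: those for the mirror images of the centre
    in the sides other than [L], and for the reflections of these points in [L], already cut out the
    union. It is thus a finite intersection of bisector half-planes, and angles never enter. The
    union depends on [L] only, so one domain serves all centres on that side.

    Boundary points of [Q] may be fixed by reflections of [G], so a coincidence [g z = h w]
    identifies the tiles only if one of the two points is interior. Statements about closed tiles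
    are obtained from interior points by density.

    Distances are compared through the rational function [qd]. It is preserved by both kinds of
    isometry, and its change under a reflection factors, which makes side conditions and distance
    inequalities interchangeable. At infinity the stabilizer could a priori contain dilations; they
    are excluded because above some height [Q] is a full vertical strip. *)

Local Notation reh z := (complex.Re (uval z)).
Local Notation imh z := (complex.Im (uval z)).
Local Notation nsq z := (reh z ^+ 2 + imh z ^+ 2).

(** * Coordinates, half-planes and reflections *)

Section Coordinates.
Variable R : realType.
Implicit Types (z w p : uhp R) (f g : uhp R -> uhp R).

Lemma uhp_eq z w : reh z = reh w -> imh z = imh w -> z = w.
Proof.
move=> hr hi; apply: val_inj => /=.
by case: z w hr hi => [[a b] ?] [[c d] ?] /= -> ->.
Qed.

Lemma imh_gt0 z : 0 < imh z. Proof. exact: uval_Im_gt0. Qed.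

Definition uhp_of (a b : R) (h : 0 < b) : uhp R := @Uhp R (a +i* b) h.

(* [|z - w|^2 / (Im z Im w)], which is [2 cosh d - 2]. *)
Definition qd z w : R :=
  ((reh z - reh w) ^+ 2 + (imh z - imh w) ^+ 2) / (imh z * imh w).

Lemma qd_ge0 z w : 0 <= qd z w.
Proof.
by rewrite divr_ge0 ?addr_ge0 ?sqr_ge0 // mulr_ge0 ?ltW ?imh_gt0.
Qed.

Lemma qdC z w : qd z w = qd w z.
Proof. by rewrite /qd; congr (_ / _); ring. Qed.

Lemma qdzz z : qd z z = 0.
Proof. by rewrite /qd !subrr expr0n addr0 mul0r. Qed.

Lemma qd_eq0 z w : qd z w = 0 -> z = w.
Proof.
have zy := imh_gt0 z; have wy := imh_gt0 w.
move=> /eqP; rewrite /qd mulf_eq0 invr_eq0 mulf_eq0 (gt_eqF zy) (gt_eqF wy) /= orbF.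
rewrite paddr_eq0 ?sqr_ge0 // !sqrf_eq0 !subr_eq0 => /andP[/eqP ? /eqP ?].
exact: uhp_eq.
Qed.

(** With [u = 1 + qd / 2] the distance is [arcosh u], and both [ln] and [u + sqrt (u^2 - 1)]
    increase for [u >= 1]. *)
Lemma hdist_le z w z' w' : (hdist z w <= hdist z' w') = (qd z w <= qd z' w').
Proof.
pose F (t : R) := ln (1 + t / 2 + Num.sqrt ((1 + t / 2) ^+ 2 - 1)).
have Fle (s t : R) : 0 <= s -> 0 <= t -> (F s <= F t) = (s <= t).
  move=> s0 t0.
  have pos (u : R) : 0 <= u -> 1 + u / 2 + Num.sqrt ((1 + u / 2) ^+ 2 - 1) \is Num.pos.
    by move=> u0; rewrite posrE ltr_pwDl ?sqrtr_ge0 //; lra.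
  have key (a b : R) : 0 <= a -> a <= b -> 1 + a / 2 + Num.sqrt ((1 + a / 2) ^+ 2 - 1)
       <= 1 + b / 2 + Num.sqrt ((1 + b / 2) ^+ 2 - 1).
    by move=> a0 ab; rewrite lerD ?ler_sqrt ?lerD2l ?lerD2r ?ler_pM2r ?ler_sqr ?nnegrE //; nra.
  have keyS (a b : R) : 0 <= a -> a < b -> 1 + a / 2 + Num.sqrt ((1 + a / 2) ^+ 2 - 1)
       < 1 + b / 2 + Num.sqrt ((1 + b / 2) ^+ 2 - 1).
    move=> a0 ab; rewrite ltr_leD //; first by lra.
    by rewrite ler_sqrt; nra.
  rewrite /F ler_ln ?pos //; apply/idP/idP; last exact: key.
  by apply: contraTT; rewrite -!ltNge => ?; apply: keyS.
have E u v : hdist u v = F (qd u v).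
  rewrite /hdist /F /qd; have uy := imh_gt0 u; have vy := imh_gt0 v.
  have -> : ((reh u - reh v) ^+ 2 + (imh u - imh v) ^+ 2) / (2 * imh u * imh v)
     = ((reh u - reh v) ^+ 2 + (imh u - imh v) ^+ 2) / (imh u * imh v) / 2.
    by field; rewrite !gt_eqF.
  by [].
by rewrite !E Fle ?qd_ge0.
Qed.

(* In the coordinates [(Re z, |z|^2)] geodesics are straight lines, so
   half-planes are given by functions that are affine in them. *)
Definition aff (a b c : R) z : R := a + b * reh z + c * nsq z.

(** After multiplication by [Im p Im p' Im z] the quadratic terms in [z] combine into [|z|^2], which
    leaves an affine function. *)
Lemma qd_bisector p p' z : (qd p z <= qd p' z) =
  (0 <= aff (imh p * nsq p' - imh p' * nsq p)
            (2 * (imh p' * reh p - imh p * reh p')) (imh p - imh p') z).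
Proof.
have py := imh_gt0 p; have py' := imh_gt0 p'; have zy := imh_gt0 z.
rewrite -subr_ge0 -(pmulr_rge0 _ (mulr_gt0 (mulr_gt0 py py') zy)).
congr (0 <= _); rewrite /qd /aff; field; by rewrite !gt_eqF.
Qed.

(** The discriminant equals [4 (Im p Im p')^2 qd p p'], so the bisector of distinct points is a
    genuine geodesic. *)
Lemma bisector_disc p p' : p <> p' ->
  0 < (2 * (imh p' * reh p - imh p * reh p')) ^+ 2 -
      4 * (imh p * nsq p' - imh p' * nsq p) * (imh p - imh p').
Proof.
move=> pp'; have py := imh_gt0 p; have py' := imh_gt0 p'.
have -> : (2 * (imh p' * reh p - imh p * reh p')) ^+ 2 -
      4 * (imh p * nsq p' - imh p' * nsq p) * (imh p - imh p')
   = 4 * (imh p * imh p') ^+ 2 * qd p p'.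
  by rewrite /qd; field; rewrite !gt_eqF.
have q0 : 0 < qd p p'.
  by rewrite lt_def qd_ge0 andbT; apply/eqP => /qd_eq0.
by rewrite mulr_gt0 // mulr_gt0 // exprn_gt0 // mulr_gt0.
Qed.

Definition geo_a (L : geodesic R) : R :=
  match L with Vertical x => - x | HalfCircle x r => x ^+ 2 - r%:num ^+ 2 end.
Definition geo_b (L : geodesic R) : R :=
  match L with Vertical x => 1 | HalfCircle x r => - (2 * x) end.
Definition geo_c (L : geodesic R) : R :=
  match L with Vertical x => 0 | HalfCircle x r => 1 end.

Lemma geodesic_eqnE L z : geodesic_eqn L z = aff (geo_a L) (geo_b L) (geo_c L) z.
Proof. by case: L => [x|x r]; rewrite /aff /=; ring. Qed.

Lemma geo_disc L : 0 < geo_b L ^+ 2 - 4 * geo_a L * geo_c L.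
Proof.
case: L => [x|x r] /=; first by lra.
have r0 : 0 < r%:num by [].
have : 0 < r%:num ^+ 2 by rewrite exprn_gt0.
by nra.
Qed.

(** A positive discriminant says that [a + b x + c x^2] has two distinct zeros on the boundary, one
    of them at infinity when [c = 0]: they are the ends of the geodesic. The sign lost in
    normalising [b] or [c] to 1 decides between the two sides. *)
Lemma half_planeP (S : set (uhp R)) : half_plane S <->
  exists a b c : R, 0 < b ^+ 2 - 4 * a * c /\ S = [set z | 0 <= aff a b c z].
Proof.
split=> [[L [->|->]]|[a [b [c [d0 ->]]]]].
- exists (geo_a L), (geo_b L), (geo_c L); split; first exact: geo_disc.
  by apply/seteqP; split=> z /=; rewrite /side_pos /= geodesic_eqnE.
- exists (- geo_a L), (- geo_b L), (- geo_c L); split.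
    by have := geo_disc L; lra.
  by apply/seteqP; split=> z /=; rewrite /side_neg /= geodesic_eqnE /aff; lra.
have scale (L : geodesic R) k : k != 0 ->
    (forall z, geodesic_eqn L z = k * aff a b c z) ->
    half_plane [set z | 0 <= aff a b c z].
  move=> k0 E; exists L; case: (ltrgtP k 0) k0 => // kk _; [right|left];
    apply/seteqP; split=> z /=; rewrite /side_pos /side_neg /= E.
  - by rewrite nmulr_rle0.
  - by rewrite nmulr_rle0.
  - by rewrite pmulr_rge0.
  - by rewrite pmulr_rge0.
have [c0|c0] := eqVneq c 0.
  have b0 : b != 0 by apply/eqP => b0; move: d0; rewrite b0 c0; lra.
  apply: (scale (Vertical (- a / b)) b^-1); first by rewrite invr_eq0.
  by move=> z /=; rewrite /aff c0; field.
set rr := (b ^+ 2 - 4 * a * c) / (4 * c ^+ 2).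
have rr0 : 0 < rr.
  by rewrite divr_gt0 // mulr_gt0 // exprn_even_gt0.
have sr0 : 0 < Num.sqrt rr by rewrite sqrtr_gt0.
apply: (scale (HalfCircle (- b / (2 * c)) (PosNum sr0)) c^-1).
  by rewrite invr_eq0.
move=> z /=; rewrite sqr_sqrtr ?ltW // /rr /aff; field.
by rewrite c0.
Qed.

Lemma half_plane_bisector (p p' : uhp R) : p <> p' ->
  half_plane [set z | qd p z <= qd p' z].
Proof.
move=> pp'; apply/half_planeP; do 3 eexists.
split; first exact: (bisector_disc pp').
by apply/seteqP; split=> z /=; rewrite qd_bisector.
Qed.

Definition refl_re (L : geodesic R) z : R :=
  match L with
  | Vertical x => 2 * x - reh z
  | HalfCircle x r => x + r%:num ^+ 2 * (reh z - x) / ((reh z - x) ^+ 2 + imh z ^+ 2)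
  end.

Definition refl_im (L : geodesic R) z : R :=
  match L with
  | Vertical x => imh z
  | HalfCircle x r => r%:num ^+ 2 * imh z / ((reh z - x) ^+ 2 + imh z ^+ 2)
  end.

Lemma sqrD_gt0 z x : 0 < (reh z - x) ^+ 2 + imh z ^+ 2.
Proof. by rewrite ltr_pwDr ?sqr_ge0 // exprn_gt0 ?imh_gt0. Qed.

Lemma refl_im_gt0 L z : 0 < refl_im L z.
Proof.
case: L => [x|x r] /=; first exact: imh_gt0.
by rewrite divr_gt0 ?sqrD_gt0 // mulr_gt0 ?imh_gt0 // exprn_gt0.
Qed.

Definition refl L z : uhp R := uhp_of (refl_re L z) (refl_im_gt0 L z).

Lemma reflection_in_refl L : reflection_in L (refl L).
Proof.
case: L => [x|x r] z /=.
  case: z => [[u v] h] /=; apply/eqP.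
  by rewrite eq_complex /= opprK add0r !eqxx.
have := sqrD_gt0 z x; case: z => [[u v] h] /= D0.
apply/eqP; rewrite eq_complex /=; apply/andP; split; apply/eqP.
  field; rewrite ?oppr0 ?addr0 ?sqrrN; lra.
by field; rewrite ?oppr0 ?addr0 ?sqrrN; lra.
Qed.

Lemma reflection_inP L f : reflection_in L f -> f = refl L.
Proof.
move=> hf; apply/funext => z; apply: val_inj => /=.
by have := reflection_in_refl L z; rewrite -(hf z).
Qed.

Definition refl_k L : R := match L with Vertical _ => 4 | HalfCircle _ r => r%:num ^- 2 end.

Lemma refl_k_gt0 L : 0 < refl_k L.
Proof. by case: L => [x|x r] //=; rewrite invr_gt0 exprn_gt0. Qed.

(** The correction is a positive multiple of the product of the two values of the equation of [L],
    hence nonnegative exactly when the points do not lie strictly on opposite sides. The constant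
    [refl_k] is what expanding the squares leaves over. *)
Lemma qd_refl L x z : qd x (refl L z) =
  qd x z + refl_k L * (geodesic_eqn L x * geodesic_eqn L z) / (imh x * imh z).
Proof.
have xy := imh_gt0 x; have zy := imh_gt0 z; rewrite /qd.
case: L => [c|c r] /=; first by field; rewrite !gt_eqF.
have := sqrD_gt0 z c => D0.
by field; rewrite (gt_eqF D0) !gt_eqF.
Qed.

Lemma qd_refl_le L x z :
  (qd x z <= qd x (refl L z)) = (0 <= geodesic_eqn L x * geodesic_eqn L z).
Proof.
have xy := imh_gt0 x; have zy := imh_gt0 z.
rewrite qd_refl lerDl pmulr_lge0 ?invr_gt0 ?mulr_gt0 //.
by rewrite pmulr_rge0 ?refl_k_gt0.
Qed.

Lemma refl_fix L z : geodesic_eqn L z = 0 -> refl L z = z.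
Proof.
by move=> E; apply/esym/qd_eq0; rewrite qd_refl E !mulr0 mul0r addr0 qdzz.
Qed.

Lemma reflK L z : refl L (refl L z) = z.
Proof.
apply/uhp_eq; case: L => [x|x r] /=; rewrite ?subKr //;
have := sqrD_gt0 z x => D0; have zy := imh_gt0 z.
all: have r0 : 0 < r%:num by [].
all: rewrite [x + _ - x]addrAC subrr add0r.
all: set u := reh z - x in D0 *; set D := _ + _ in D0 *.
all: have -> : (r%:num ^+ 2 * u / D) ^+ 2 + (r%:num ^+ 2 * imh z / D) ^+ 2 = r%:num ^+ 4 / D
  by rewrite [in RHS](_ : r%:num ^+ 4 / D = r%:num ^+ 4 * D / D ^+ 2) /D; field; rewrite gt_eqF.
all: by rewrite /u; field; rewrite !gt_eqF.
Qed.

Lemma refl_ne L z : geodesic_eqn L z != 0 -> z <> refl L z.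
Proof.
move=> z0 E; have := qd_refl L z z; rewrite -E qdzz add0r => /esym/eqP.
have zy := imh_gt0 z; have k0 := refl_k_gt0 L.
by rewrite !mulf_eq0 (negbTE z0) invr_eq0 mulf_eq0 (gt_eqF zy) (gt_eqF k0).
Qed.

End Coordinates.

(** * Isometries *)

Section Isometries.
Variable R : realType.
Implicit Types (z w p : uhp R) (f g : uhp R -> uhp R) (a b c d e : R).

Definition denom c d z : R := (c * reh z + d) ^+ 2 + (c * imh z) ^+ 2.

(* Real coordinates of [(a z + b) / (c z + d)] for [ad - bc = 1] and of
   [(a z^* + b) / (c z^* + d)] for [ad - bc = -1]: the formulas agree. *)
Definition acts a b c d f := forall z,
  reh (f z) = (a * c * nsq z + (a * d + b * c) * reh z + b * d) / denom c d z /\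
  imh (f z) = imh z / denom c d z.

Definition mobius e f := exists a b c d, a * d - b * c = e /\ acts a b c d f.

Lemma denom_gt0 a b c d z : a * d - b * c != 0 -> 0 < denom c d z.
Proof.
move=> h; have zy := imh_gt0 z; rewrite /denom lt_def addr_ge0 ?sqr_ge0 // andbT.
rewrite paddr_eq0 ?sqr_ge0 // !sqrf_eq0 mulf_eq0 (gt_eqF zy) orbF.
apply/negP => /andP[/eqP h1 /eqP h2]; move: h1 h; rewrite h2 mul0r add0r => ->.
by rewrite !mulr0 subr0 eqxx.
Qed.

Lemma det2E (A : 'M[R]_2) : \det A = A 0 0 * A 1 1 - A 0 1 * A 1 0.
Proof.
rewrite (expand_det_row _ 0) big_ord_recl big_ord1 /cofactor /= !det_mx11 !mxE /=.
have -> : lift 0 0 = 1 :> 'I_2 by apply/val_inj.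
have -> : lift 1 0 = 0 :> 'I_2 by apply/val_inj.
by rewrite expr0 expr1; ring.
Qed.

Lemma preserving_matrixP (A : 'M[R]_2) f : preserving_matrix A f <->
  A 0 0 * A 1 1 - A 0 1 * A 1 0 = 1 /\ acts (A 0 0) (A 0 1) (A 1 0) (A 1 1) f.
Proof.
rewrite /preserving_matrix det2E; set a := A 0 0; set b := A 0 1.
set c := A 1 0; set d := A 1 1.
suff key z : a * d - b * c = 1 ->
    ((a%:C * uval z + b%:C) / (c%:C * uval z + d%:C)) =
    ((a * c * nsq z + (a * d + b * c) * reh z + b * d) / denom c d z) +i*
    (imh z / denom c d z).
  split=> -[h1 h2]; split=> // z; first by rewrite h2 key.
  by rewrite key //; have [<- <-] := h2 z; case: (f z) => [[]].
move=> h1; have := @denom_gt0 a b c d z; rewrite h1 oner_neq0 => /(_ isT).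
rewrite /denom; case: z => [[x y] /= y0] D0.
apply/eqP; rewrite eq_complex /=; apply/andP; split; apply/eqP.
  by field; apply/eqP; lra.
rewrite [X in _ = X / _](_ : y = y * (a * d - b * c)); last by rewrite h1 mulr1.
by field; apply/eqP; lra.
Qed.

Lemma mx2E a b c d : exists A : 'M[R]_2,
  [/\ A 0 0 = a, A 0 1 = b, A 1 0 = c & A 1 1 = d].
Proof.
exists (\matrix_(i < 2, j < 2) (if i == 0 then if j == 0 then a else b
   else if j == 0 then c else d)).
by rewrite !mxE.
Qed.

Lemma mobius_preservingP f : mobius 1 f <-> orientation_preserving f.
Proof.
split=> [[a [b [c [d [h1 h2]]]]]|[A /preserving_matrixP [h1 h2]]].
  have [A [e1 e2 e3 e4]] := mx2E a b c d; exists A.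
  by apply/preserving_matrixP; rewrite e1 e2 e3 e4.
by do 4 eexists; split; last exact: h2.
Qed.

Lemma acts_qd a b c d f z w : (a * d - b * c) ^+ 2 = 1 -> acts a b c d f ->
  qd (f z) (f w) = qd z w.
Proof.
move=> h1 h2; rewrite /qd; have [-> ->] := h2 z; have [-> ->] := h2 w.
have h0 : a * d - b * c != 0.
  by apply/eqP => h; move: h1; rewrite h expr0n /= => /eqP; rewrite eq_sym oner_eq0.
have zy := imh_gt0 z; have wy := imh_gt0 w.
have := denom_gt0 z h0; have := denom_gt0 w h0; rewrite /denom => Dw Dz.
(* The formulas of [acts] carry no determinant in the imaginary part; putting its square back in
   place of 1 turns the claim into an identity of rational functions. *)
rewrite -[X in (_ + X) / _]mul1r -[RHS]mul1r -h1; field.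
by rewrite !gt_eqF.
Qed.

Lemma mobius_qd e f z w : e ^+ 2 = 1 -> mobius e f -> qd (f z) (f w) = qd z w.
Proof. by move=> h [a [b [c [d [E]]]]]; apply: acts_qd; rewrite E. Qed.

Lemma sqr1_neq0 (x : R) : x ^+ 2 = 1 -> x != 0.
Proof. by move=> h; rewrite -sqrf_eq0 h oner_eq0. Qed.

Lemma acts_comp a b c d f a' b' c' d' g :
  a * d - b * c != 0 -> (a' * d' - b' * c') ^+ 2 = 1 ->
  acts a b c d f -> acts a' b' c' d' g ->
  acts (a * a' + b * c') (a * b' + b * d') (c * a' + d * c') (c * b' + d * d')
       (f \o g).
Proof.
move=> he h hf hg z /=; have [-> ->] := hf (g z).
have Dg := denom_gt0 (g z) he; have Dz := denom_gt0 z (sqr1_neq0 h).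
have zy := imh_gt0 z.
have fg : denom (c * a' + d * c') (c * b' + d * d') z =
          denom c d (g z) * denom c' d' z.
  rewrite [in RHS]/denom; have [-> ->] := hg z.
  rewrite [X in _ = (_ + X) * _ ](_ : _ = (c * imh z) ^+ 2 / denom c' d' z ^+ 2 * (a' * d' - b' * c') ^+ 2); last first.
    by rewrite h; field; rewrite gt_eqF.
  by move: Dz; rewrite /denom => Dz; field; rewrite gt_eqF.
rewrite fg; split; last first.
  by have [_ ->] := hg z; field; rewrite !gt_eqF.
have [-> ->] := hg z.
rewrite [(imh z / _) ^+ 2](_ : _ = imh z ^+ 2 / denom c' d' z ^+ 2 * (a' * d' - b' * c') ^+ 2); last first.
  by rewrite h; field; rewrite gt_eqF.
set Dgz := denom c d (g z) in Dg *.
by move: Dz; rewrite /denom => Dz; field; rewrite !gt_eqF.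
Qed.

Lemma mobius_comp e e' f g : e ^+ 2 = 1 -> e' ^+ 2 = 1 ->
  mobius e f -> mobius e' g -> mobius (e * e') (f \o g).
Proof.
move=> he he' [a [b [c [d [E hf]]]]] [a' [b' [c' [d' [E' hg]]]]].
do 4 eexists; split; last first.
  by apply: acts_comp hf hg; rewrite ?E ?E' // sqr1_neq0.
by rewrite -E -E'; ring.
Qed.

(** A matrix times its adjugate is the determinant times the identity; this is the form in which the
    composites in [mobius_inv] appear, for both signs of [e]. *)
Lemma acts_scalar e f : e ^+ 2 = 1 -> acts e 0 0 e f -> f = id.
Proof.
move=> he h; apply/funext => z; have [h1 h2] := h z; have e0 := sqr1_neq0 he.
apply: uhp_eq; rewrite ?h1 ?h2 /denom; first by field; rewrite e0.
by rewrite mul0r add0r mul0r expr0n addr0 he divr1.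
Qed.

Lemma mobius_id : mobius 1 (@id (uhp R)).
Proof.
exists 1, 0, 0, 1; split; first by ring.
by move=> z; rewrite /denom; split; field; rewrite ?oner_eq0.
Qed.

Lemma mobius_inv e f : e ^+ 2 = 1 -> mobius e f ->
  exists g, [/\ mobius e g, f \o g = id & g \o f = id].
Proof.
move=> he [a [b [c [d [E hf]]]]].
have e0 := sqr1_neq0 he.
have E' : d * a - (- b) * (- c) = e by rewrite -E; ring.
have D0 z : 0 < denom (- c) a z by apply: (@denom_gt0 d (- b)); rewrite E'.
have I0 z : 0 < imh z / denom (- c) a z by rewrite divr_gt0 ?imh_gt0.
pose g z := uhp_of ((d * (- c) * nsq z + (d * a + (- b) * (- c)) * reh z + (- b) * a) /
   denom (- c) a z) (I0 z).
have hg : acts d (- b) (- c) a g by [].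
exists g; split; first by exists d, (- b), (- c), a.
  apply: (acts_scalar he); have := acts_comp _ _ hf hg; rewrite E E' => /(_ e0 he).
  congr acts; rewrite -?E; ring.
apply: (acts_scalar he); have := acts_comp _ _ hg hf; rewrite E E' => /(_ e0 he).
congr acts; rewrite -?E; ring.
Qed.

(** Orientation is well defined. The two formulas, compared at [i], [2i] and [1 + i], give equal
    [c^2], [d^2], [cd], [ac], [bd] and [ad + bc]. So [cd (ad - bc)] is the same for both although
    the determinants are opposite; hence [cd = 0], and either case contradicts the equality of
    [ad + bc]. *)
Lemma mobius_sign f : mobius 1 f -> mobius (-1) f -> False.
Proof.
move=> [a [b [c [d [E hf]]]]] [a' [b' [c' [d' [E' hg]]]]].
have D1 z := denom_gt0 z (_ : a * d - b * c != 0).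
have D2 z := denom_gt0 z (_ : a' * d' - b' * c' != 0).
rewrite E oner_eq0 in D1; rewrite E' oppr_eq0 oner_eq0 in D2.
have {}D1 z := D1 isT z; have {}D2 z := D2 isT z.
have eD z : denom c d z = denom c' d' z.
  have [_ h1] := hf z; have [_] := hg z; rewrite h1.
  by move/(mulfI (lt0r_neq0 (imh_gt0 z)))/invr_inj.
have eN z : a * c * nsq z + (a * d + b * c) * reh z + b * d =
            a' * c' * nsq z + (a' * d' + b' * c') * reh z + b' * d'.
  have [h1 _] := hf z; have [+ _] := hg z; rewrite h1 -eD.
  by apply: mulIf; rewrite invr_eq0 gt_eqF.
have two0 : 0 < 2 :> R by [].
pose z1 := uhp_of 0 (@ltr01 R); pose z2 := uhp_of 0 two0.
pose z3 := uhp_of 1 (@ltr01 R).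
have := (eD z1, eD z2, eD z3, (eN z1, eN z2, eN z3)); rewrite /denom /=.
move=> [[[d1 d2] d3] [[n1 n2] n3]].
have c2 : c ^+ 2 = c' ^+ 2 by lra.
have d2' : d ^+ 2 = d' ^+ 2 by lra.
have cd : c * d = c' * d' by lra.
have ac : a * c = a' * c' by lra.
have bd : b * d = b' * d' by lra.
have adbc : a * d + b * c = a' * d' + b' * c' by lra.
have : c * d * (a * d - b * c) = c' * d' * (a' * d' - b' * c').
  have -> : c * d * (a * d - b * c) = (a * c) * d ^+ 2 - (b * d) * c ^+ 2 by ring.
  by rewrite ac bd c2 d2'; ring.
rewrite E E' -cd => cd0.
have {}cd0 : c * d = 0 by lra.
have /eqP := cd0; rewrite mulf_eq0 => /orP[] /eqP h0.
  have c0' : c' = 0 by apply/eqP; rewrite -sqrf_eq0 -c2 h0 expr0n.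
  by rewrite h0 c0' in E E' adbc; lra.
have d0' : d' = 0 by apply/eqP; rewrite -sqrf_eq0 -d2' h0 expr0n.
by rewrite h0 d0' in E E' adbc; lra.
Qed.

Lemma mobius_refl L : mobius (-1) (@refl R L).
Proof.
case: L => [x|x r].
  exists (-1), (2 * x), 0, 1; split; first by ring.
  by move=> z; rewrite /denom; split=> /=; field; rewrite ?oner_eq0.
have r0 : r%:num != 0 by [].
(* The evident matrix of [x + r^2 / (z^* - x)] has determinant [-r^2]; division by [r] normalises it
   to -1. *)
exists (x / r%:num), ((r%:num ^+ 2 - x ^+ 2) / r%:num), (r%:num^-1), (- x / r%:num).
split; first by field.
move=> z; have := sqrD_gt0 z x; rewrite /denom => D0; split => /=.
  field.
  by rewrite (gt_eqF D0) r0.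
field.
by rewrite (gt_eqF D0) r0.
Qed.

End Isometries.

(** * Topology *)

Section Topology.
Variable R : realType.
Implicit Types (z w p : uhp R) (S : set (uhp R)).

Lemma nbhs_box z S : nbhs z S <->
  exists2 e : R, 0 < e & forall w, `|reh z - reh w| < e -> `|imh z - imh w| < e -> S w.
Proof.
split.
  rewrite nbhsE => -[B [[U oU <-] Uz] BS].
  have /nbhs_ballP [e /= e0 eU] : nbhs (ucoord z) U by apply: open_nbhs_nbhs.
  by exists e => // w h1 h2; apply: BS; apply: eU; split.
move=> [e e0 h].
rewrite nbhsE; exists (@ucoord R @^-1` (ball (ucoord z) e)°).
  split; first by exists (ball (ucoord z) e)° => //; exact: open_interior.
  exact: nbhsx_ballx.
by move=> w /interior_subset [h1 h2]; exact: h.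
Qed.

(** Isometries preserve [qd], so this description of neighbourhoods is the one they transport. *)
Lemma nbhs_qd z S : nbhs z S <-> exists2 e : R, 0 < e & forall w, qd z w < e -> S w.
Proof.
have zy := imh_gt0 z; rewrite nbhs_box; split=> -[e e0 h].
  (* The bound 1/2 keeps [Im w] below [4 Im z]; the other bound then turns [qd z w] into a Euclidean
     estimate. *)
  exists (Num.min (2^-1) (e ^+ 2 / (4 * imh z ^+ 2))).
    by rewrite lt_min invr_gt0 ltr0n /= divr_gt0 ?mulr_gt0 ?exprn_gt0.
  move=> w; have wy := imh_gt0 w.
  rewrite /qd ltr_pdivrMr ?mulr_gt0 // => hw.
  set m := Num.min _ _ in hw.
  have m2 : m <= 2^-1 by rewrite ge_min lexx.
  have m0 : 0 <= m.
    by rewrite /m le_min invr_ge0 ler0n /= mulr_ge0 ?sqr_ge0 // invr_ge0 mulr_ge0 ?sqr_ge0.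
  have me : m * (4 * imh z ^+ 2) <= e ^+ 2.
    by rewrite -ler_pdivlMr ?mulr_gt0 ?exprn_gt0 // ge_min lexx orbT.
  have yy0 : 0 < imh z * imh w by rewrite mulr_gt0.
  have w4 : imh w < 4 * imh z.
    rewrite ltNge; apply/negP => w4.
    have : m * (imh z * imh w) <= 2^-1 * (imh z * imh w) by rewrite ler_pM2r.
    have := sqr_ge0 (reh z - reh w).
    have : imh w * (imh w - 4 * imh z) >= 0 by rewrite mulr_ge0 // ?subr_ge0 // ltW.
    nra.
  have : m * (imh z * imh w) <= e ^+ 2.
    apply: le_trans me; rewrite ler_wpM2l //; nra.
  move=> me2.
  have sq (x : R) : x ^+ 2 < e ^+ 2 -> `|x| < e.
    by move=> h2; rewrite -ltr_sqr ?nnegrE ?(ltW e0) // real_normK ?num_real.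
  have := sqr_ge0 (reh z - reh w); have := sqr_ge0 (imh z - imh w).
  by move=> ? ?; apply: h; apply: sq; lra.
(* Since [s <= 1/2], the height of [w] is at least [Im z / 2], a lower bound for the denominator of
   [qd]. *)
pose s := Num.min (2^-1) (e / 4).
have s0 : 0 < s by rewrite lt_min invr_gt0 ltr0n divr_gt0.
have s2 : s <= 2^-1 by rewrite ge_min lexx.
have se : s <= e / 4 by rewrite ge_min lexx orbT.
exists (imh z * s); first by rewrite mulr_gt0.
move=> w h1 h2; apply: h; have wy := imh_gt0 w.
rewrite /qd ltr_pdivrMr ?mulr_gt0 //.
have sq (x : R) : `|x| < imh z * s -> x ^+ 2 < (imh z * s) ^+ 2.
  move=> hx; rewrite -real_normK ?num_real // ltr_pXn2r ?nnegrE //.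
  by rewrite mulr_ge0 ?ltW.
have {}h1 := sq _ h1.
have wz : imh w >= imh z / 2.
  move: h2; rewrite ltr_norml => /andP[_ h2].
  have : imh z * s <= imh z * 2^-1 by rewrite ler_pM2l.
  lra.
have {}h2 := sq _ h2.
have : (imh z * s) ^+ 2 <= imh z ^+ 2 * (2^-1 * (e / 4)).
  by rewrite exprMn ler_pM2l ?exprn_gt0 // expr2 ler_pM // ltW.
have : imh z ^+ 2 * e / 2 <= e * (imh z * imh w).
  have -> : imh z ^+ 2 * e / 2 = e * (imh z * (imh z / 2)) by field.
  by rewrite !ler_pM2l.
have : 0 < imh z ^+ 2 * e by rewrite mulr_gt0 ?exprn_gt0.
lra.
Qed.

Lemma interior_image (f g : uhp R -> uhp R) S :
  (forall z w, qd (f z) (f w) = qd z w) -> f \o g = id -> g \o f = id ->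
  f @` S° = (f @` S)°.
Proof.
move=> fi fg gf.
have fgE z : f (g z) = z by rewrite -[LHS]/((f \o g) z) fg.
have gfE z : g (f z) = z by rewrite -[LHS]/((g \o f) z) gf.
have gi z w : qd (g z) (g w) = qd z w by rewrite -fi !fgE.
apply/seteqP; split=> [_ [z /nbhs_qd [e e0 h] <-]|z /nbhs_qd [e e0 h]].
  apply/nbhs_qd; exists e => // w zw; exists (g w) => //.
  by apply: h; rewrite -fi fgE.
exists (g z) => //; apply/nbhs_qd; exists e => // w gzw.
have [w' Sw' E] : (f @` S) (f w) by apply: h; rewrite -gi gfE.
by rewrite -(gfE w) -E gfE.
Qed.

Lemma aff_nbhs (a b c : R) z : 0 < aff a b c z -> nbhs z [set w | 0 < aff a b c w].
Proof.
move=> h; have zy := imh_gt0 z.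
(* A Lipschitz constant for [aff a b c] on the unit box around [z]; the final 1 keeps it
   positive. *)
set K : R := `|b| + `|c| * (2 * `|reh z| + 2 * imh z + 2) + 1.
have K0 : 0 < K.
  by rewrite /K ltr_wpDl // addr_ge0 // mulr_ge0 // !addr_ge0 ?mulr_ge0 // ltW.
apply/nbhs_box; exists (Num.min 1 (aff a b c z / K)).
  by rewrite lt_min ltr01 divr_gt0.
move=> w; rewrite !lt_min => /andP[x1 xe] /andP[y1 ye] /=.
set dx := reh z - reh w in x1 xe *; set dy := imh z - imh w in y1 ye *.
have -> : aff a b c w = aff a b c z -
    (b * dx + c * ((2 * reh z - dx) * dx + (2 * imh z - dy) * dy)).
  by rewrite /aff /dx /dy; ring.
rewrite subr_gt0; apply: le_lt_trans (ler_norm _) _.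
set m : R := Num.max `|dx| `|dy|.
have mK : m * K < aff a b c z by rewrite -ltr_pdivlMr // gt_max xe ye.
have xm : `|dx| <= m by rewrite le_max lexx.
have ym : `|dy| <= m by rewrite le_max lexx orbT.
have m0 : 0 <= m by apply: le_trans xm.
apply: le_lt_trans mK; rewrite /K [leRHS]mulrDr mulr1 -[leLHS]addr0 lerD //.
apply: le_trans (ler_normD _ _) _; rewrite [leRHS]mulrDr lerD // ?normrM.
  by rewrite mulrC ler_wpM2r.
rewrite mulrCA ler_wpM2l //.
apply: le_trans (ler_normD _ _) _; rewrite !normrM.
have -> : m * (2 * `|reh z| + 2 * imh z + 2) =
   (2 * `|reh z| + 1) * m + (2 * imh z + 1) * m by ring.
rewrite lerD // ler_pM //; apply: le_trans (ler_normB _ _) _.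
  by rewrite lerD ?normrM ?normr_nat // ltW.
by rewrite lerD ?normrM ?normr_nat ?(gtr0_norm zy) // ltW.
Qed.

Lemma aff_scale (a b c k : R) z : aff (k * a) (k * b) (k * c) z = k * aff a b c z.
Proof. by rewrite /aff; ring. Qed.

Lemma aff_ex (a b c : R) : 0 < b ^+ 2 - 4 * a * c -> exists z, 0 < aff a b c z.
Proof.
move=> d0; have [c0|c0|c0] := ltrgtP c 0.
(* The half-plane is a half-disc here; the point taken lies above its centre, at half the squared
   radius. *)
- pose t := (b ^+ 2 - 4 * a * c) / (8 * c ^+ 2).
  have t0 : 0 < t by rewrite divr_gt0 // mulr_gt0 // exprn_even_gt0 //= lt_eqF.
  have st0 : 0 < Num.sqrt t by rewrite sqrtr_gt0.
  exists (uhp_of (- b / (2 * c)) st0); rewrite /aff /= sqr_sqrtr ?ltW //.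
  have -> : a + b * (- b / (2 * c)) + c * ((- b / (2 * c)) ^+ 2 + t) =
            (b ^+ 2 - 4 * a * c) / (- (8 * c)).
    by rewrite /t; field; rewrite lt_eqF.
  by rewrite divr_gt0 // oppr_gt0 pmulr_rlt0.
- have y0 : 0 < (1 + `|a|) / c + 1 by rewrite ltr_wpDl ?divr_ge0 ?addr_ge0 // ltW.
  exists (uhp_of 0 y0); rewrite /aff /= mulr0 addr0 expr0n /= add0r.
  have E : c * ((1 + `|a|) / c + 1) = 1 + `|a| + c by field; rewrite gt_eqF.
  have := ler_norm (- a); rewrite normrN => na.
  rewrite expr2 mulrA E.
  have : 0 <= (1 + `|a|) / c by rewrite divr_ge0 ?addr_ge0 // ltW.
  have := normr_ge0 a.
  set v := (1 + `|a|) / c; nra.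
- have b0 : b != 0 by apply/eqP => b0; move: d0; rewrite b0 c0; lra.
  exists (uhp_of ((1 - a) / b) (@ltr01 R)); rewrite /aff c0 /=.
  by rewrite mul0r addr0 mulrC divfK // addrC subrK ltr01.
Qed.

(** The coordinates [(Re z, |z|^2)] map the half-plane onto the convex region [v > x^2], so a convex
    combination of two points again comes from a point, on the geodesic segment between them. *)
Lemma segment_point z w (s : R) : 0 <= s <= 1 -> exists p,
  [/\ reh p = (1 - s) * reh z + s * reh w, nsq p = (1 - s) * nsq z + s * nsq w
    & forall a b c, aff a b c p = (1 - s) * aff a b c z + s * aff a b c w].
Proof.
move=> /andP[s0 s1]; have zy := imh_gt0 z; have wy := imh_gt0 w.
set x := (1 - s) * reh z + s * reh w; set v := (1 - s) * nsq z + s * nsq w.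
have y0 : 0 < v - x ^+ 2.
  have -> : v - x ^+ 2 = (1 - s) * imh z ^+ 2 + s * imh w ^+ 2 +
     s * (1 - s) * (reh z - reh w) ^+ 2 by rewrite /v /x; ring.
  have s1' : 0 <= 1 - s by rewrite subr_ge0.
  apply: ltr_pwDl; last by rewrite mulr_ge0 ?sqr_ge0 // mulr_ge0.
  have [->|sn0] := eqVneq s 0; first by rewrite subr0 mul1r mul0r addr0 exprn_gt0.
  apply: ltr_wpDl; first by rewrite mulr_ge0 ?sqr_ge0.
  by rewrite mulr_gt0 ?exprn_gt0 // lt_def sn0.
have sy0 : 0 < Num.sqrt (v - x ^+ 2) by rewrite sqrtr_gt0.
have E : nsq (uhp_of x sy0) = v by rewrite /= sqr_sqrtr ?ltW // addrC subrK.
exists (uhp_of x sy0); split=> // a b c.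
by rewrite /aff E /= /v /x; ring.
Qed.

Lemma segment_near z w S : nbhs z S -> exists (s : R) p,
  [/\ 0 < s < 1, S p &
   forall a b c, aff a b c p = (1 - s) * aff a b c z + s * aff a b c w].
Proof.
move=> /nbhs_box [e e0 h]; have zy := imh_gt0 z; have wy := imh_gt0 w.
pose A : R := `|reh w - reh z|; pose B : R := `|nsq w - nsq z|.
pose E := B + (1 + 2 * `|reh z|) * A + A ^+ 2.
have A0 : 0 <= A by exact: normr_ge0.
have B0 : 0 <= B by exact: normr_ge0.
have E0 : 0 <= E.
  by rewrite addr_ge0 ?sqr_ge0 // addr_ge0 // mulr_ge0 // addr_ge0 // mulr_ge0.
have Ey0 : 0 <= E / imh z by rewrite divr_ge0 // ltW.
(* [C] bounds the displacement per unit of [s]: [A] horizontally, and [E / Im z] vertically, by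
   factoring the difference of the squared heights. *)
pose C := A + E / imh z + 1.
have Cp : 0 < C by rewrite /C; lra.
pose s := Num.min (2^-1) (e / (2 * C)).
have s0 : 0 < s by rewrite lt_min invr_gt0 ltr0n divr_gt0 // mulr_gt0.
have s2 : s <= 2^-1 by rewrite ge_min lexx.
have sC : s * C < e.
  apply: (@le_lt_trans _ _ (e / 2)); last lra.
  have : s <= e / (2 * C) by rewrite ge_min lexx orbT.
  rewrite ler_pdivlMr ?mulr_gt0 //; lra.
have s01 : 0 <= s <= 1 by apply/andP; split; lra.
have [p [px pv pa]] := segment_point z w s01.
exists s, p; split=> //; first by apply/andP; split; lra.
have dx : reh z - reh p = - (s * (reh w - reh z)) by rewrite px; ring.
have dv : nsq z - nsq p = - (s * (nsq w - nsq z)) by rewrite pv; ring.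
apply: h.
  rewrite dx normrN normrM gtr0_norm //; apply: le_lt_trans sC.
  rewrite ler_pM2l // -/A /C; lra.
have py := imh_gt0 p.
have dy : (imh z - imh p) * (imh z + imh p) =
   - (s * (nsq w - nsq z)) + 2 * reh z * (s * (reh w - reh z)) + s ^+ 2 * (reh w - reh z) ^+ 2.
  have -> : (imh z - imh p) * (imh z + imh p) = (nsq z - nsq p) - (reh z - reh p) * (reh z + reh p) by ring.
  by rewrite dv dx px; ring.
have : `|imh z - imh p| * imh z <= s * E.
  apply: (@le_trans _ _ (`|imh z - imh p| * (imh z + imh p))).
    by rewrite ler_wpM2l // lerDl ltW.
  rewrite -[X in _ * X <= _]gtr0_norm ?addr_gt0 // -normrM dy.
  rewrite /E; apply: le_trans (ler_normD _ _) _; rewrite [leRHS]mulrDr lerD //.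
    apply: le_trans (ler_normD _ _) _; rewrite [leRHS]mulrDr lerD //.
      by rewrite normrN normrM gtr0_norm.
    rewrite !normrM (gtr0_norm s0) gtr0_norm // mulrCA ler_pM2l //.
    by rewrite ler_wpM2r // lerDr.
  rewrite normrM !normrX (gtr0_norm s0) ler_wpM2r ?sqr_ge0 // expr2.
  by rewrite ler_piMr // ?ltW //; lra.
rewrite -ler_pdivlMr // => hy; apply: le_lt_trans hy _; apply: le_lt_trans sC.
rewrite -mulrA ler_pM2l // /C; lra.
Qed.

End Topology.

(** * Polygons *)

Section Polygons.
Variable R : realType.
Implicit Types (z w p : uhp R) (S Q : set (uhp R)) (c : geodesic R * bool).

(** The boolean chooses the side of the geodesic, so that a polygon needs only inequalities of the
    form [0 <= side_eqn c z]. *)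
Definition side_eqn c z : R := (-1) ^+ c.2 * geodesic_eqn c.1 z.

Lemma side_eqn_aff c : exists a b d : R,
  0 < b ^+ 2 - 4 * a * d /\ forall z, side_eqn c z = aff a b d z.
Proof.
exists ((-1) ^+ c.2 * geo_a c.1), ((-1) ^+ c.2 * geo_b c.1), ((-1) ^+ c.2 * geo_c c.1).
split; last by move=> z; rewrite /side_eqn geodesic_eqnE /aff; ring.
have := geo_disc c.1; case: c.2; rewrite ?expr1 ?expr0; lra.
Qed.

Lemma side_eqn_eq0 c z : (side_eqn c z == 0) = (geodesic_eqn c.1 z == 0).
Proof. by rewrite /side_eqn mulf_eq0 signr_eq0. Qed.

Lemma half_plane_side_eqn S : half_plane S <-> exists c, S = [set z | 0 <= side_eqn c z].
Proof.
split=> [[L [->|->]]|[[L [] ->]]].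
- by exists (L, false); apply/seteqP; split=> z; rewrite /side_eqn /= expr0 mul1r.
- exists (L, true); apply/seteqP; split=> z;
    by rewrite /side_eqn /side_neg /= expr1 mulN1r oppr_ge0.
- exists L; right; apply/seteqP; split=> z;
    by rewrite /side_eqn /side_neg /= expr1 mulN1r oppr_ge0.
- by exists L; left; apply/seteqP; split=> z; rewrite /side_eqn /= expr0 mul1r.
Qed.

(** From a point of the boundary line, a small step towards a point of the opposite half-plane would
    leave [S]. *)
Lemma side_eqn_interior c S z : S `<=` [set w | 0 <= side_eqn c w] -> S° z -> 0 < side_eqn c z.
Proof.
move=> SH Sz; have := SH z (interior_subset Sz) => /= h0.
rewrite lt_def h0 andbT; apply/eqP => hz0.
have [a [b [d [disc E]]]] := side_eqn_aff c.
have [w ww] : exists w, 0 < aff (-1 * a) (-1 * b) (-1 * d) w.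
  by apply: aff_ex; lra.
rewrite aff_scale in ww.
have [s [p [s01 Sp mix]]] := segment_near w Sz.
have := SH _ Sp; rewrite /= E mix -!E hz0.
case/andP: s01 => s0 _.
have : 0 < s * - side_eqn c w by rewrite mulr_gt0 // E; lra.
lra.
Qed.

Lemma side_eqn_segment c z w p (s : R) :
  (forall a b d, aff a b d p = (1 - s) * aff a b d z + s * aff a b d w) ->
  side_eqn c p = (1 - s) * side_eqn c z + s * side_eqn c w.
Proof. by move=> mix; have [a [b [d [_ E]]]] := side_eqn_aff c; rewrite !E mix. Qed.

Lemma side_eqn_nbhs c z : 0 < side_eqn c z -> nbhs z [set w | 0 < side_eqn c w].
Proof.
have [a [b [d [_ E]]]] := side_eqn_aff c; rewrite E => /aff_nbhs.
by apply: filterS => w /=; rewrite E.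
Qed.

Lemma qd_lt_nbhs p p' z : qd p' z < qd p z -> nbhs z [set w | qd p' w < qd p w].
Proof.
have E w : (qd p' w < qd p w) = (0 < aff (-1 * (imh p * nsq p' - imh p' * nsq p))
      (-1 * (2 * (imh p' * reh p - imh p * reh p'))) (-1 * (imh p - imh p')) w).
  by rewrite ltNge qd_bisector -ltNge aff_scale mulN1r oppr_gt0.
by rewrite E => /aff_nbhs; apply: filterS => w /=; rewrite E.
Qed.

Definition polygon_of n (C : 'I_n -> geodesic R * bool) : set (uhp R) :=
  [set z | forall i, 0 <= side_eqn (C i) z].

Lemma polygon_of_interior n (C : 'I_n -> geodesic R * bool) z :
  (forall i, 0 < side_eqn (C i) z) -> (polygon_of C)° z.
Proof.
move=> h; have : nbhs z [set w | forall i, 0 < side_eqn (C i) w].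
  by apply: (@filter_forall _ _ (fun i w => 0 < side_eqn (C i) w) (nbhs z)) => i; exact: side_eqn_nbhs.
by apply: filterS => w hw i; apply: ltW.
Qed.

Lemma interior_polygon_of n (C : 'I_n -> geodesic R * bool) z i :
  (polygon_of C)° z -> 0 < side_eqn (C i) z.
Proof. by apply: side_eqn_interior => w; apply. Qed.

(** On the way from [z] to the interior point [p] each side function is interpolated between a
    nonnegative and a positive value. *)
Lemma polygon_of_dense n (C : 'I_n -> geodesic R * bool) p z U :
  (polygon_of C)° p -> polygon_of C z -> nbhs z U -> exists2 w, U w & (polygon_of C)° w.
Proof.
move=> Cp Cz /(segment_near p)[s [w [s01 Uw mix]]]; exists w => //.
apply: polygon_of_interior => i; rewrite (side_eqn_segment _ mix).
have := interior_polygon_of i Cp; have := Cz i; nra.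
Qed.

Lemma polygonE Q : polygon Q -> exists n (C : 'I_n -> geodesic R * bool), Q = polygon_of C.
Proof.
move=> [[n [S [hS ->]]] _ _]; have /choice [C hC] : forall i, exists c, S i = [set z | 0 <= side_eqn c z].
  by move=> i; apply/half_plane_side_eqn.
exists n, C; apply/seteqP; split=> [z h i|z h i _].
  by have := h i I; rewrite hC.
by rewrite hC; apply: h.
Qed.

Lemma line_ex (L : geodesic R) z : exists2 w, w <> z & geodesic_eqn L w = 0.
Proof.
have two : 0 < 2 :> R by [].
case: L => [x|x r].
  have [e|e] := eqVneq (imh z) 1.
    exists (uhp_of x two); rewrite /= ?subrr // => E.
    by move: e; rewrite -E /=; lra.
  exists (uhp_of x ltr01); rewrite /= ?subrr // => E.
  by move: e; rewrite -E eqxx.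
have r0 : 0 < r%:num by [].
(* The 3-4-5 triangle supplies a point of the half-circle other than its top. *)
have r1 : 0 < 4 / 5 * r%:num by rewrite mulr_gt0.
have [e|e] := eqVneq (reh z) x.
  exists (uhp_of (x + 3 / 5 * r%:num) r1); rewrite /=; last by field.
  by move=> E; move: e; rewrite -E /=; lra.
exists (uhp_of x r0); rewrite /= ?subrr; last by ring.
by move=> E; move: e; rewrite -E eqxx.
Qed.

Lemma polygon_of_reindex n (C : 'I_n -> geodesic R * bool) (J : {set 'I_n}) :
  polygon_of (C \o @enum_val _ (mem J)) = [set z | forall i, i \in J -> 0 <= side_eqn (C i) z].
Proof.
apply/seteqP; split=> z /= h i.
  by move=> iJ; have := h (enum_rank_in iJ i); rewrite /= enum_rankK_in.
by apply: h; exact: enum_valP.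
Qed.

(* Take a minimal family of half-planes cutting out [Q]. *)
Lemma polygon_sides Q : polygon Q -> exists n (C : 'I_n -> geodesic R * bool),
  Q = polygon_of C /\
  forall j, exists z0 z1, [/\ z0 <> z1, geodesic_eqn (C j).1 z0 = 0,
    geodesic_eqn (C j).1 z1 = 0 &
    forall i, i != j -> 0 < side_eqn (C i) z0 /\ 0 < side_eqn (C i) z1].
Proof.
move=> pQ; have [n [C EQ]] := polygonE pQ; have [_ [p Qp] _] := pQ.
pose P (J : {set 'I_n}) := `[< Q = [set z | forall i, i \in J -> 0 <= side_eqn (C i) z] >].
have [J /minsetP[/asboolP PJ minJ]] : {J | minset P J}.
  apply: ex_minset; exists [set: 'I_n]%SET; apply/asboolP; rewrite EQ.
  by apply/seteqP; split=> z h i; [move=> _|]; apply: h; rewrite ?finset.inE.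
exists #|J|, (C \o @enum_val _ (mem J)); split; first by rewrite polygon_of_reindex.
move=> j; pose k := @enum_val _ (mem J) j; have kJ : k \in J by apply: enum_valP.
(* By minimality, dropping side [k] enlarges the set: [x] violates that inequality alone. *)
have [x xk xJ] : exists2 x, side_eqn (C k) x < 0 &
    forall i, i \in J -> i != k -> 0 <= side_eqn (C i) x.
  apply: contrapT => nx; have : P (J :\ k)%SET.
    apply/asboolP; rewrite PJ; apply/seteqP; split=> z h i.
      by rewrite finset.inE => /andP[_]; exact: h.
    move=> iJ; have [->|ik] := eqVneq i k; last by apply: h; rewrite finset.inE finset.in_set1 ik.
    rewrite leNgt; apply/negP => zk; apply: nx; exists z => // i' i'J i'k.
    by apply: h; rewrite finset.inE finset.in_set1 i'k.
  move=> /minJ /(_ (subsetDl _ _)) /finset.setP /(_ k).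
  by rewrite finset.inE finset.in_set1 eqxx kJ.
have pJ i : i \in J -> 0 < side_eqn (C i) p.
  by move=> iJ; apply: side_eqn_interior Qp => z; rewrite EQ; apply.
have pk := pJ k kJ.
(* The parameter at which the segment from [p] to [x] crosses side [k]. Since [s < 1], the other
   functions, positive at [p] and nonnegative at [x], are still positive there. *)
pose s := side_eqn (C k) p / (side_eqn (C k) p - side_eqn (C k) x).
have den : 0 < side_eqn (C k) p - side_eqn (C k) x by lra.
have s01 : 0 <= s <= 1.
  by apply/andP; split; rewrite /s; [rewrite divr_ge0 // ltW|rewrite ler_pdivrMr //; lra].
have s1 : s < 1 by rewrite ltr_pdivrMr //; lra.
have [e [_ _ mix]] := segment_point p x s01.
have ek : side_eqn (C k) e = 0.
  by rewrite (side_eqn_segment _ mix) /s; field; rewrite gt_eqF.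
have eJ i : i \in J -> i != k -> 0 < side_eqn (C i) e.
  move=> iJ ik; rewrite (side_eqn_segment _ mix).
  have := pJ i iJ; have := xJ i iJ ik; move: s01 s1 => /andP[s0 _] s1 h1 h2.
  apply: ltr_pwDl; last exact: mulr_ge0.
  by apply: mulr_gt0 => //; rewrite subr_gt0.
(* A short step from [e] along the same line keeps the finitely many strict inequalities and gives
   the second point. *)
have [w we wk] := line_ex (C k).1 e.
have ne : nbhs e [set w | forall i, i \in J -> i != k -> 0 < side_eqn (C i) w].
  apply: (@filter_forall _ _ (fun i w => i \in J -> i != k -> 0 < side_eqn (C i) w) (nbhs e)) => i; have [iJ|iJ] := boolP (i \in J); last first.
    by apply: filterS filterT => w' _.
  have [ik|ik] := eqVneq i k; first by apply: filterS filterT => w' _ _.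
  by apply: filterS (side_eqn_nbhs (eJ i iJ ik)) => w' ? _ _.
have [t [e' [t01 he' mix']]] := segment_near w ne.
have e'k : side_eqn (C k) e' = 0.
  have wk' : side_eqn (C k) w = 0 by apply/eqP; rewrite side_eqn_eq0 wk.
  by rewrite (side_eqn_segment _ mix') ek wk' !mulr0 addr0.
exists e, e'; split.
- move=> ee'; apply: we; rewrite -ee' in mix'.
  have t0 : 0 < t by case/andP: t01.
  have aE a b d : aff a b d e = aff a b d w.
    have := mix' a b d => h; have {}h : t * (aff a b d e - aff a b d w) = 0 by lra.
    by move/eqP: h; rewrite mulf_eq0 gt_eqF //= subr_eq0 => /eqP.
  have hr : reh w = reh e.
    by have := aE 0 1 0; rewrite /aff; lra.
  apply: uhp_eq => //; have := aE 0 0 1; rewrite /aff hr.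
  have ey := imh_gt0 e; have wy := imh_gt0 w => h.
  have {}h : imh w ^+ 2 = imh e ^+ 2 by lra.
  by apply/eqP; rewrite -(@eqrXn2 _ 2) ?ltW // h.
- by apply/eqP; rewrite -side_eqn_eq0; apply/eqP.
- by apply/eqP; rewrite -side_eqn_eq0; apply/eqP.
move=> i ij; have ik : enum_val i != k by rewrite (inj_eq enum_val_inj).
have iJ : enum_val i \in J by exact: enum_valP.
by split; [exact: eJ|apply: he'].
Qed.

Lemma polygon_of_bears n (C : 'I_n -> geodesic R * bool) j z0 z1 :
  z0 <> z1 -> geodesic_eqn (C j).1 z0 = 0 -> geodesic_eqn (C j).1 z1 = 0 ->
  (forall i, i != j -> 0 < side_eqn (C i) z0 /\ 0 < side_eqn (C i) z1) ->
  bears_side (polygon_of C) (C j).1.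
Proof.
move=> z01 e0 e1 h; split.
  case E : (C j).2; [right|left] => z /(_ j); rewrite /side_eqn E /side_neg /side_pos /=.
    by rewrite expr1 mulN1r oppr_ge0.
  by rewrite expr0 mul1r.
exists z0, z1; split=> //; split=> // i; have [->|ij] := eqVneq i j.
- by rewrite /side_eqn e0 mulr0.
- by apply: ltW; case: (h i ij).
- by rewrite /side_eqn e1 mulr0.
- by apply: ltW; case: (h i ij).
Qed.

End Polygons.

(** * Reflection groups *)

Section Groups.
Variable R : realType.
Implicit Types (z w p : uhp R) (f g : uhp R -> uhp R) (G M : set (uhp R -> uhp R)).

Definition isom f := mobius 1 f \/ mobius (-1) f.

Lemma isom_qd f z w : isom f -> qd (f z) (f w) = qd z w.
Proof. by case; apply: mobius_qd; rewrite ?sqrrN expr1n. Qed.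

Lemma isom_group : is_group isom.
Proof.
have s1 : (1 : R) ^+ 2 = 1 by rewrite expr1n.
have sN1 : (-1 : R) ^+ 2 = 1 by rewrite sqrrN expr1n.
split; first by left; exact: mobius_id.
  move=> f g [hf|hf] [hg|hg]; [left|right|right|left].
  - by have := mobius_comp s1 s1 hf hg; rewrite mulr1.
  - by have := mobius_comp s1 sN1 hf hg; rewrite mul1r.
  - by have := mobius_comp sN1 s1 hf hg; rewrite mulr1.
  - by have := mobius_comp sN1 sN1 hf hg; rewrite mulrNN mulr1.
move=> f [hf|hf].
  by have [g [hg fg gf]] := mobius_inv s1 hf; exists g => //; left.
by have [g [hg fg gf]] := mobius_inv sN1 hf; exists g => //; right.
Qed.

(** An inverse has to lie in every group containing [S]. The group [M] provides a candidate, and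
    uniqueness of inverses places it in all the others. *)
Lemma generated_is_group M (S : set (uhp R -> uhp R)) :
  is_group M -> S `<=` M -> is_group (generated S).
Proof.
move=> gM SM; split.
- by move=> N [[]].
- by move=> f g hf hg N [gN SN]; case: (gN) => _ + _; apply; [exact: hf|exact: hg].
- move=> f hf; case: (gM) => _ _ /(_ f (hf M (conj gM SM)))[g Mg [fg gf]].
  exists g => // N [gN SN]; case: (gN) => _ _ /(_ f (hf N (conj gN SN)))[g' Ng' [fg' gf']].
  suff -> : g = g' by [].
  by rewrite -[g]/(id \o g) -gf' -compA fg.
Qed.

(** Turns a Euclidean cluster point of an orbit into orbit points at small [qd] from each other. The
    bound [s <= 1/2] keeps heights above half of [p.2]; [s <= e / 32] absorbs the remaining
    factors. *)
Lemma orbit_ball (p : R * R) (e : R) : 0 < p.2 -> 0 < e ->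
  exists2 B, nbhs p B & forall z w, B (ucoord z) -> B (ucoord w) -> qd z w < e.
Proof.
move=> y0 e0; pose s : R := Num.min (2^-1) (e / 32).
have s0 : 0 < s by rewrite lt_min invr_gt0 ltr0n divr_gt0.
have s2 : s <= 2^-1 by rewrite ge_min lexx.
have se : s <= e / 32 by rewrite ge_min lexx orbT.
have r0 : 0 < p.2 * s by rewrite mulr_gt0.
exists (ball p (p.2 * s)); first exact: nbhsx_ballx.
move=> z w [/= zx zy] [/= wx wy].
rewrite /ball /= in zx zy wx wy.
have r2 : p.2 * s <= p.2 * 2^-1 by rewrite ler_pM2l.
move: zx zy wx wy; rewrite !ltr_norml => /andP[z1 z2] /andP[z3 z4] /andP[w1 w2] /andP[w3 w4].
have iz : p.2 / 2 <= imh z by lra.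
have iw : p.2 / 2 <= imh w by lra.
have zp := imh_gt0 z; have wp := imh_gt0 w.
rewrite /qd ltr_pdivrMr ?mulr_gt0 //.
have sq (a b : R) : - (2 * b) < a -> a < 2 * b -> a ^+ 2 < 4 * b ^+ 2 by move=> ? ?; nra.
have h1 : (reh z - reh w) ^+ 2 < 4 * (p.2 * s) ^+ 2 by apply: sq; lra.
have h2 : (imh z - imh w) ^+ 2 < 4 * (p.2 * s) ^+ 2 by apply: sq; lra.
have h3 : (p.2 * s) ^+ 2 <= p.2 ^+ 2 * (2^-1 * (e / 32)).
  by rewrite exprMn ler_pM2l ?exprn_gt0 // expr2 ler_pM // ltW.
have h4 : e * (p.2 ^+ 2 / 4) <= e * (imh z * imh w).
  rewrite ler_pM2l //.
  have -> : p.2 ^+ 2 / 4 = (p.2 / 2) * (p.2 / 2) by field.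
  by rewrite ler_pM // divr_ge0 // ltW.
have h5 : 0 < p.2 ^+ 2 * e by rewrite mulr_gt0 // exprn_gt0.
lra.
Qed.

(** If [qd z w <= T], the ratio [q] of the heights satisfies [(1 - q)^2 <= T q], so [q] and its
    inverse are at most [2 + T]. This keeps the box away from the real line and bounds the
    horizontal displacement. *)
Lemma qd_ball_compact (z : uhp R) (T : R) : exists2 K : set (R * R), compact K &
  (forall w, qd z w <= T -> K (ucoord w)) /\ (forall u : R * R, K u -> 0 < u.2).
Proof.
wlog T0 : T / 0 <= T.
  move=> H; have [/H//|T0] := leP 0 T.
  have [K cK [h1 h2]] := H 0 (lexx 0); exists K => //; split=> // w hw.
  by apply: h1; apply: le_trans hw (ltW T0).
have zy := imh_gt0 z.
pose M : R := (2 + T) * imh z.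
have M0 : 0 < M by rewrite mulr_gt0 // ltr_wpDr.
have T2 : 0 < 2 + T by rewrite ltr_wpDr.
exists (`[reh z - M, reh z + M] `*` `[imh z / (2 + T), M]).
  by apply: compact_setX; exact: segment_compact.
split=> [w|p [_ /=]]; last first.
  by rewrite in_itv /= => /andP[+ _]; apply: lt_le_trans; rewrite divr_gt0.
have wy := imh_gt0 w; rewrite /qd ler_pdivrMr ?mulr_gt0 // => h.
have hx := sqr_ge0 (reh z - reh w); have hy := sqr_ge0 (imh z - imh w).
have w1 : imh w <= M.
  rewrite /M -(ler_pM2l wy); nra.
have w2 : imh z / (2 + T) <= imh w.
  rewrite ler_pdivrMr // -(ler_pM2l zy); nra.
have h3 : (reh z - reh w) ^+ 2 <= M ^+ 2.
  have : T * (imh z * imh w) <= T * (imh z * M) by rewrite ler_wpM2l // ler_pM2l.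
  have -> : T * (imh z * M) = T * (2 + T) * imh z ^+ 2 by rewrite /M; ring.
  rewrite /M exprMn; have : 0 <= imh z ^+ 2 by exact: sqr_ge0.
  have : 0 <= T * imh z ^+ 2 by rewrite mulr_ge0 ?sqr_ge0.
  nra.
have : `|reh z - reh w| <= M.
  by rewrite -ler_sqr ?nnegrE ?(ltW M0) // real_normK ?num_real.
rewrite ler_norml => /andP[h4 h5].
by split; rewrite /= in_itv /=; apply/andP; split; lra.
Qed.

End Groups.

Section ReflectionGroup.
Variables (R : realType) (Q : set (uhp R)) (G : set (uhp R -> uhp R)).
Hypothesis hG : discrete_reflection_group Q G.
Implicit Types (z w p : uhp R) (f g h : uhp R -> uhp R).

Lemma refl_group_sides_isom :
  [set f | exists2 L, bears_side Q L & reflection_in L f] `<=` @isom R.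
Proof. by move=> f [L _ /reflection_inP ->]; right; exact: mobius_refl. Qed.

Lemma refl_group_isom g : G g -> isom g.
Proof.
case: hG => _ -> _ _; exact: (smallest_sub (@isom_group R) refl_group_sides_isom).
Qed.

Lemma refl_group_group : is_group G.
Proof.
case: hG => _ -> _ _; exact: (generated_is_group (@isom_group R) refl_group_sides_isom).
Qed.

Lemma refl_group_refl L : bears_side Q L -> G (refl L).
Proof.
case: hG => _ -> _ _ hL N [gN SN]; apply: SN; exists L => //.
exact: reflection_in_refl.
Qed.

Lemma refl_group_comp g h : G g -> G h -> G (g \o h).
Proof. by case: refl_group_group => _ H _; exact: H. Qed.

Lemma refl_group_inv g : G g -> exists h, [/\ G h, g \o h = id & h \o g = id].
Proof. by case: refl_group_group => _ _ H /H[h Gh [? ?]]; exists h. Qed.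

Lemma refl_group_qd g z w : G g -> qd (g z) (g w) = qd z w.
Proof. by move=> /refl_group_isom; exact: isom_qd. Qed.

Lemma refl_group_interior g (S : set (uhp R)) : G g -> g @` S° = (g @` S)°.
Proof.
move=> Gg; have [h [Gh gh hg]] := refl_group_inv Gg.
by apply: interior_image gh hg => z w; exact: refl_group_qd.
Qed.

Lemma refl_group_eq g h z w : G g -> G h -> Q° z -> Q° w -> g z = h w -> g = h.
Proof.
move=> Gg Gh Qz Qw E; apply: contrapT => gh.
case: hG => _ _ _ [_ /(_ g h Gg Gh gh)]; rewrite -!refl_group_interior //.
move=> /seteqP[/(_ (g z)) + _]; apply; split; first by exists z.
by exists w.
Qed.

(** The image of the interior of [Q] under [h^-1 g] is a neighbourhood of [w], and interior points
    are dense in [Q], so the two tiles overlap in their interiors. *)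
Lemma refl_group_eq_near g h z w : G g -> G h -> Q° z -> Q w -> g z = h w -> g = h.
Proof.
move=> Gg Gh Qz Qw E; have [h' [Gh' hh' h'h]] := refl_group_inv Gh.
have [pQ _ _ _] := hG; have [n [C EQ]] := polygonE pQ.
have : nbhs w ((h' \o g) @` Q°).
  rewrite refl_group_interior; last exact: refl_group_comp.
  suff : ((h' \o g) @` Q)° w by exact: nbhs_interior.
  rewrite -refl_group_interior; last exact: refl_group_comp.
  by exists z => //=; rewrite E -[LHS]/((h' \o h) w) h'h.
rewrite EQ in Qz Qw * => /(polygon_of_dense Qz Qw)[w' [z' Qz' <-] Qw'].
apply: (@refl_group_eq _ _ z' ((h' \o g) z')) => //; rewrite ?EQ //=.
by rewrite -[RHS]/((h \o h') (g z')) hh'.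
Qed.

(* The orbit points closer and closer to the infimum would cluster in a compact
   set, where distinct orbit points stay apart. *)
Lemma refl_group_orbit_min x z : Q° z ->
  exists2 g, G g & forall h, G h -> qd x (g z) <= qd x (h z).
Proof.
move=> Qz; have Gid : G id by case: refl_group_group.
pose O : set R := [set qd x (g z) | g in G].
have hO : has_inf O.
  split; first by exists (qd x z); exists id.
  by exists 0 => _ [g _ <-]; exact: qd_ge0.
apply: contrapT => nmin.
have low g : G g -> inf O < qd x (g z).
  move=> Gg; rewrite lt_def; apply/andP; split; last by apply: ge_inf; [case: hO|exists g].
  apply/eqP => E; apply: nmin; exists g => // h Gh; rewrite E.
  by apply: ge_inf; [case: hO|exists h].
have [e e0 he] : exists2 e : R, 0 < e & forall w, qd z w < e -> Q° w.
  by apply/nbhs_qd; exact: nbhs_interior.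
have sep g h : G g -> G h -> qd (g z) (h z) < e -> g = h.
  move=> Gg Gh gh; have [g' [Gg' gg' g'g]] := refl_group_inv Gg.
  apply: (@refl_group_eq _ _ (g' (h z)) z) => //.
    apply: he; rewrite -(refl_group_qd _ _ Gg).
    by rewrite -[X in qd _ X]/((g \o g') (h z)) gg'.
  by rewrite -[LHS]/((g \o g') (h z)) gg'.
have [K cK [hK1 hK2]] := qd_ball_compact x (inf O + 1).
pose A (t : R) := @ucoord R @` [set w | exists2 g, G g & w = g z /\ qd x w < inf O + t].
have fF : Filter (filter_from [set t : R | 0 < t] A).
  apply: filter_from_filter; first by exists 1; rewrite /= ltr01.
  move=> s t /= s0 t0; exists (Num.min s t); first by rewrite /= lt_min s0 t0.
  move=> _ [w [g Gg [-> hw]] <-]; split; exists (g z) => //; exists g => //; split=> //.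
    by apply: lt_le_trans hw _; rewrite lerD2l ge_min lexx.
  by apply: lt_le_trans hw _; rewrite lerD2l ge_min lexx orbT.
have pF : ProperFilter (filter_from [set t : R | 0 < t] A).
  apply: filter_from_proper => t /= t0.
  have [_ [g Gg <-] hg] := inf_adherent t0 hO.
  by exists (ucoord (g z)); exists (g z) => //; exists g.
have [p [Kp clp]] : K `&` cluster (filter_from [set t : R | 0 < t] A) !=set0.
  apply: cK; exists 1; first by rewrite /= ltr01.
  by move=> _ [w [g Gg [-> hw]] <-]; apply: hK1; apply: ltW.
have [B nB hB] := orbit_ball (hK2 _ Kp) e0.
have [_ [[w1 [g1 Gg1 [E1 h1]] <-] B1]] := clp (A 1) B (ex_intro2 _ _ 1 ltr01 (fun _ => id)) nB.
(* The excess of [w1] over the infimum is positive because the infimum is not attained. As a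
   threshold it yields an orbit point [w2] strictly nearer to [x], yet so close to [w1] that both
   come from the same group element. *)
have t0 : 0 < qd x w1 - inf O by rewrite subr_gt0 E1; exact: low.
have FA : filter_from [set t : R | 0 < t] A (A (qd x w1 - inf O)) by exists (qd x w1 - inf O).
have [_ [[w2 [g2 Gg2 [E2 h2]] <-] B2]] := clp _ B FA nB.
rewrite addrC subrK in h2.
have E : g1 = g2 by apply: sep => //; rewrite -E1 -E2; exact: hB.
by rewrite E1 E2 E ltxx in h2.
Qed.

Lemma refl_group_min_interior x z g : Q° x -> Q° z -> G g -> qd x z <= qd x (g z).
Proof.
move=> Qx Qz Gg; have [g0 Gg0 min0] := refl_group_orbit_min x Qz.
suff E : g0 z = z by rewrite -{1}E min0.
have [pQ _ _ _] := hG; have [n [C [EQ sides]]] := polygon_sides pQ.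
suff Qg : Q (g0 z).
  have Gid : G id by case: refl_group_group.
  by have -> : g0 = id by exact: (@refl_group_eq_near _ _ z (g0 z)).
rewrite EQ => j; have [z0 [z1 [z01 e0 e1 hz]]] := sides j.
have Gr : G (refl (C j).1).
  by apply: refl_group_refl; rewrite [in bears_side _ _]EQ; exact: (polygon_of_bears z01 e0 e1 hz).
have := min0 _ (refl_group_comp Gr Gg0); rewrite /= qd_refl_le => h0.
rewrite EQ in Qx; have := interior_polygon_of j Qx; move: h0; rewrite /side_eqn.
by case: (C j).2; rewrite /= ?expr1 ?expr0 => ? ?; nra.
Qed.

(** A strict violation is an open condition in each variable, so it would persist at interior
    points; the inequality extends to all [z] in [Q], then to all [x]. The identity [swap] makes it
    a comparison with two fixed points. *)
Lemma refl_group_min x z g : Q x -> Q z -> G g -> qd x z <= qd x (g z).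
Proof.
move=> Qx Qz Gg; have [pQ _ _ _] := hG; have [n [C EQ]] := polygonE pQ.
have [_ [p Qp] _] := pQ; have [h [Gh gh hg]] := refl_group_inv Gg.
have swap x' z' : qd x' (g z') = qd (h x') z'.
  by rewrite -[RHS](refl_group_qd _ _ Gg) -[X in _ = qd X _]/((g \o h) x') gh.
have step x' z' : Q° x' -> Q z' -> qd x' z' <= qd x' (g z').
  move=> Qx' Qz'; rewrite leNgt; apply/negP; rewrite swap => /qd_lt_nbhs.
  move=> nz; rewrite EQ in Qp Qz'; have [w hw Qw] := polygon_of_dense Qp Qz' nz.
  rewrite -EQ in Qw; move: hw => /=; rewrite -swap ltNge.
  by rewrite refl_group_min_interior.
rewrite leNgt; apply/negP; rewrite qdC [qd x z]qdC => /qd_lt_nbhs nx.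
rewrite EQ in Qp Qx; have [w hw Qw] := polygon_of_dense Qp Qx nx.
rewrite -EQ in Qw; move: hw => /=; rewrite ltNge qdC [qd _ w]qdC.
by rewrite step.
Qed.

End ReflectionGroup.

(** * Polygons near the ideal boundary *)

Section IdealBoundary.
Variable R : realType.
Implicit Types (z w p : uhp R) (S Q : set (uhp R)) (a b c x : R).

Lemma fin_eps n (P : 'I_n -> R -> Prop) :
  (forall i, exists2 e : R, 0 < e & forall h, 0 < h < e -> P i h) ->
  exists2 e : R, 0 < e & forall i h, 0 < h < e -> P i h.
Proof.
move=> H; have /choice [e he] : forall i, exists e : R, 0 < e /\ forall h, 0 < h < e -> P i h.
  by move=> i; have [e e0 he] := H i; exists e.
exists (\big[Num.min/1]_i e i).
  by apply: lt_bigmin => // i _; case: (he i).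
move=> i h /andP[h0 h1]; have [_] := he i; apply; rewrite h0.
by apply: lt_le_trans h1 _; exact: bigmin_le.
Qed.

Lemma aff_shift a b c x z : aff a b c z =
  (a + b * x + c * x ^+ 2) + (b + 2 * c * x) * (reh z - x) + c * (reh z - x) ^+ 2 + c * imh z ^+ 2.
Proof. by rewrite /aff; ring. Qed.

Lemma quad_small (g1 c e h : R) : 0 < e -> 0 < h < Num.min 1 (e / (`|g1| + `|c| + 1)) ->
  `|g1 * h + c * h ^+ 2| < e.
Proof.
move=> e0; have K0 : 0 < `|g1| + `|c| + 1 by rewrite ltr_wpDl // addr_ge0.
rewrite lt_min ltr_pdivlMr // => /andP[h0 /andP[h1 he]].
apply: le_lt_trans he; apply: le_trans (ler_normD _ _) _.
rewrite [`|g1 * h|]normrM [`|c * _|]normrM normrX (gtr0_norm h0).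
have : `|c| * h ^+ 2 <= `|c| * h by rewrite ler_wpM2l // expr2 ler_piMl // ltW.
have := normr_ge0 g1; have := normr_ge0 c; lra.
Qed.

(* Near a boundary point [x], on its right, a half-plane either contains an
   interval of the boundary or pinches against it. *)
Lemma boundary_germ a b c x : 0 < b ^+ 2 - 4 * a * c ->
  (exists2 e : R, 0 < e & forall h, 0 < h < e ->
     0 <= a + b * (x + h) + c * (x + h) ^+ 2) \/
  (exists e K : R, [/\ 0 < e, 0 < K & forall z, 0 <= aff a b c z ->
     0 < reh z - x < e -> reh z - x <= K * imh z ^+ 2]).
Proof.
move=> disc; set g0 := a + b * x + c * x ^+ 2; set g1 := b + 2 * c * x.
have Eg h : a + b * (x + h) + c * (x + h) ^+ 2 = g0 + (g1 * h + c * h ^+ 2).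
  by rewrite /g0 /g1; ring.
(* At an end of the geodesic [g0 = 0], and this identity forces [g1 <> 0]: the zero is simple, and
   the sign of [g1] tells whether the interval to the right belongs to the half-plane. *)
have dE : g1 ^+ 2 = (b ^+ 2 - 4 * a * c) + 4 * c * g0 by rewrite /g0 /g1; ring.
have K0 : 0 < `|g1| + `|c| + 1 by rewrite ltr_wpDl // addr_ge0.
have cc : c <= `|c| := ler_norm c.
have Kc : 0 < 2 * (`|c| + 1) by rewrite mulr_gt0 // ltr_wpDl.
have [g0n|g0p|g00] := ltrgtP g0 0.
(* Here [x] is strictly outside: points of the half-plane above a neighbourhood of [x] have height
   bounded below, so [K] only has to be large. *)
- right; exists (Num.min 1 ((- g0 / 2) / (`|g1| + `|c| + 1))), (2 * (`|c| + 1) / - g0).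
  have ng0 : 0 < - g0 by rewrite oppr_gt0.
  split; first by rewrite lt_min ltr01 divr_gt0 // divr_gt0.
    by rewrite divr_gt0.
  move=> z; rewrite (aff_shift _ _ _ x) -/g0 -/g1 => hz hh.
  have ng2 : 0 < - g0 / 2 by rewrite divr_gt0.
  have := quad_small ng2 hh; move: hh; rewrite lt_min => /andP[h0 /andP[h1 _]].
  rewrite ltr_norml => /andP[_ q]; apply: le_trans (ltW h1) _.
  rewrite mulrAC ler_pdivlMr // mul1r.
  have y2 : 0 <= imh z ^+ 2 by exact: sqr_ge0.
  have : c * imh z ^+ 2 <= `|c| * imh z ^+ 2 by rewrite ler_wpM2r.
  lra.
- left; exists (Num.min 1 (g0 / (`|g1| + `|c| + 1))).
    by rewrite lt_min ltr01 divr_gt0.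
  move=> h hh; rewrite Eg; have := quad_small g0p hh.
  rewrite ltr_norml => /andP[? _]; lra.
have [g1n|g1p|g10] := ltrgtP g1 0.
- right; exists (- g1 / (2 * (`|c| + 1))), (2 * (`|c| + 1) / - g1).
  have ng1 : 0 < - g1 by rewrite oppr_gt0.
  split; [by rewrite divr_gt0 | by rewrite divr_gt0 |].
  move=> z; rewrite (aff_shift _ _ _ x) -/g0 -/g1 g00 add0r => hz.
  rewrite ltr_pdivlMr // => /andP[h0 hh].
  rewrite mulrAC ler_pdivlMr //.
  have y2 : 0 <= imh z ^+ 2 by exact: sqr_ge0.
  have : c * imh z ^+ 2 <= `|c| * imh z ^+ 2 by rewrite ler_wpM2r.
  have : c * (reh z - x) ^+ 2 <= `|c| * (reh z - x) ^+ 2 by rewrite ler_wpM2r ?sqr_ge0.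
  move: hh; set h := reh z - x in h0 hz *; move=> hh c1 c2.
  have c3 : h * (h * (2 * (`|c| + 1))) < h * - g1 by rewrite ltr_pM2l.
  have : 0 <= h ^+ 2 by exact: sqr_ge0.
  nra.
- left; exists (g1 / (`|c| + 1)); first by rewrite divr_gt0 // ltr_wpDl.
  have c1 : 0 < `|c| + 1 by rewrite ltr_wpDl.
  move=> h /andP[h0]; rewrite ltr_pdivlMr // => hh.
  rewrite Eg g00 add0r.
  have -> : g1 * h + c * h ^+ 2 = h * (g1 + c * h) by ring.
  rewrite mulr_ge0 ?ltW //.
  have : - (c * h) <= `|c| * h by rewrite -mulNr ler_wpM2r ?(ltW h0) // -normrN ler_norm.
  lra.
by move: dE; rewrite g00 g10 expr0n mulr0 addr0 /= => dE; move: disc; rewrite -dE ltxx.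
Qed.

(** The counterpart at infinity, decided by the sign of [c], or by that of [b] when [c = 0]. *)
Lemma boundary_germ_infty a b c : 0 < b ^+ 2 - 4 * a * c ->
  exists M, (forall x, M < x -> 0 <= a + b * x + c * x ^+ 2) \/
     (forall z, 0 <= aff a b c z -> reh z <= M).
Proof.
move=> disc; have aN : - a <= `|a| by rewrite -normrN ler_norm.
have bN : - b <= `|b| by rewrite -normrN ler_norm.
have aP : a <= `|a| := ler_norm a; have bP : b <= `|b| := ler_norm b.
have a0 := normr_ge0 a; have b0 := normr_ge0 b.
have [c0|c0|c0] := ltrgtP c 0.
- exists (1 + (`|a| + `|b|) / - c); right=> z hz; rewrite leNgt; apply/negP => hM.
  have nc : 0 < - c by rewrite oppr_gt0.
  have x1 : 1 < reh z.
    by apply: le_lt_trans hM; rewrite lerDl divr_ge0 ?addr_ge0 // ltW.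
  have hx : (`|a| + `|b|) < reh z * - c.
    by rewrite -ltr_pdivrMr //; apply: le_lt_trans hM; rewrite lerDr.
  have : reh z * (`|a| + `|b|) < reh z * (reh z * - c) by rewrite ltr_pM2l // (lt_trans ltr01).
  have : c * imh z ^+ 2 <= 0 by rewrite nmulr_rle0 // sqr_ge0.
  have : b * reh z <= `|b| * reh z by rewrite ler_wpM2r // ltW // (lt_trans ltr01).
  have : `|a| * 1 <= `|a| * reh z by rewrite ler_wpM2l // ltW.
  move: hz; rewrite /aff; lra.
- exists (1 + (`|a| + `|b|) / c); left=> x hM.
  have x1 : 1 < x.
    by apply: le_lt_trans hM; rewrite lerDl divr_ge0 ?addr_ge0 // ltW.
  have hx : (`|a| + `|b|) < x * c.
    by rewrite -ltr_pdivrMr //; apply: le_lt_trans hM; rewrite lerDr.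
  have : x * (`|a| + `|b|) < x * (x * c) by rewrite ltr_pM2l // (lt_trans ltr01).
  have : - b * x <= `|b| * x by rewrite ler_wpM2r // ltW // (lt_trans ltr01).
  have : `|a| * 1 <= `|a| * x by rewrite ler_wpM2l // ltW.
  lra.
have [b1|b1|b1] := ltrgtP b 0.
- exists (a / - b); right=> z; rewrite /aff c0 mul0r addr0 => hz.
  by rewrite ler_pdivlMr ?oppr_gt0 //; lra.
- exists (- a / b); left=> x; rewrite c0 mul0r addr0 ltr_pdivrMr //; lra.
by move: disc; rewrite b1 c0; lra.
Qed.

(* A half-disc is the convex hull, in the affine coordinates, of its boundary arc. *)
Lemma aff_half_disc a b c (l r : R) z : l < r ->
  (forall x, l <= x <= r -> 0 <= a + b * x + c * x ^+ 2) ->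
  (reh z - l) * (reh z - r) + imh z ^+ 2 <= 0 -> 0 <= aff a b c z.
Proof.
move=> lr H hz; have y2 : 0 < imh z ^+ 2 by rewrite exprn_gt0 // imh_gt0.
have lz : l <= reh z by nra.
have zr : reh z <= r by nra.
have hu : 0 <= a + b * reh z + c * reh z ^+ 2 by apply: H; rewrite lz.
have hl : 0 <= a + b * l + c * l ^+ 2 by apply: H; rewrite lexx ltW.
have hr : 0 <= a + b * r + c * r ^+ 2 by apply: H; rewrite lexx ltW.
have [c0|c0] := leP 0 c.
  have : 0 <= c * imh z ^+ 2 by rewrite mulr_ge0 // ltW.
  by rewrite /aff; lra.
have h1 : 0 <= (r - reh z) * (a + b * l + c * l ^+ 2) by rewrite mulr_ge0 // subr_ge0.
have h2 : 0 <= (reh z - l) * (a + b * r + c * r ^+ 2) by rewrite mulr_ge0 // subr_ge0.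
have h3 : 0 <= (r - l) * (c * ((reh z - l) * (reh z - r) + imh z ^+ 2)).
  rewrite mulr_ge0 ?subr_ge0 ?(ltW lr) //; rewrite nmulr_rge0 //.
have rl : 0 < r - l by rewrite subr_gt0.
rewrite -(pmulr_rge0 _ rl) /aff; lra.
Qed.

(** Polygons by coefficients: reflection in the imaginary axis only changes the sign of each [b i],
    which reduces estimates on the left of a boundary point to those on the right. *)
Definition triple_cut n (a b c : 'I_n -> R) : set (uhp R) :=
  [set z | forall i, 0 <= aff (a i) (b i) (c i) z].

Lemma half_disc_half_plane (l r : R) : l < r ->
  half_plane [set z : uhp R | (reh z - l) * (reh z - r) + imh z ^+ 2 <= 0].
Proof.
move=> lr; apply/half_planeP; exists (- (l * r)), (l + r), (-1); split; first by nra.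
by apply/seteqP; split=> z /=; rewrite /aff; lra.
Qed.

Lemma triple_cut_interval n (a b c : 'I_n -> R) (l r : R) : l < r ->
  (forall i x, l <= x <= r -> 0 <= a i + b i * x + c i * x ^+ 2) ->
  exists2 H, half_plane H & H `<=` triple_cut a b c.
Proof.
move=> lr h; eexists; first exact: (half_disc_half_plane lr).
by move=> z hz i; apply: (aff_half_disc lr (h i)).
Qed.

(** If no single side pinched at [x], the boundary intervals to the right of [x] would have a common
    part, and the half-disc over an interval inside it would lie in the polygon. *)
Lemma triple_cut_right n (a b c : 'I_n -> R) x :
  (forall i, 0 < b i ^+ 2 - 4 * a i * c i) ->
  (forall H, half_plane H -> ~ (H `<=` triple_cut a b c)) ->
  exists e K : R, [/\ 0 < e, 0 < K & forall z, triple_cut a b c z ->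
     0 < reh z - x < e -> reh z - x <= K * imh z ^+ 2].
Proof.
move=> disc noH.
have [[i [e [K [e0 K0 h]]]]|no] := pselect (exists i, exists e K : R, [/\ 0 < e, 0 < K &
   forall z, 0 <= aff (a i) (b i) (c i) z ->
     0 < reh z - x < e -> reh z - x <= K * imh z ^+ 2]).
  by exists e, K; split=> // z hz; apply: h.
exfalso.
have [e e0 he] : exists2 e : R, 0 < e & forall i h, 0 < h < e ->
    0 <= a i + b i * (x + h) + c i * (x + h) ^+ 2.
  apply: fin_eps => i; have [//|h] := boundary_germ x (disc i).
  by exfalso; apply: no; exists i.
have lr : x + e / 3 < x + e / 2 by lra.
have [|H hH sub] := @triple_cut_interval n a b c _ _ lr; last exact: (noH H hH sub).
move=> i x' /andP[? ?]; have -> : x' = x + (x' - x) by ring.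
by apply: he; apply/andP; split; lra.
Qed.

Lemma triple_cut_right_infty n (a b c : 'I_n -> R) :
  (forall i, 0 < b i ^+ 2 - 4 * a i * c i) ->
  (forall H, half_plane H -> ~ (H `<=` triple_cut a b c)) ->
  exists M : R, forall z, triple_cut a b c z -> reh z <= M.
Proof.
move=> disc noH.
have [[i [M h]]|no] := pselect (exists i M, forall z, 0 <= aff (a i) (b i) (c i) z -> reh z <= M).
  by exists M => z hz; apply: h.
exfalso.
have /choice [M hM] : forall i, exists M, forall x, M < x -> 0 <= a i + b i * x + c i * x ^+ 2.
  move=> i; have [M [h|h]] := boundary_germ_infty (disc i); first by exists M.
  by exfalso; apply: no; exists i, M.
pose N := \big[Num.max/0]_i M i.
have lr : N + 1 < N + 2 by lra.
have [|H hH sub] := @triple_cut_interval n a b c _ _ lr; last exact: (noH H hH sub).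
move=> i x /andP[hx _]; apply: hM; have : M i <= N by exact: le_bigmax.
lra.
Qed.

(** A half-plane consists of the points at least as near to an inner point [p] as to the mirror
    image of [p]. Isometries preserve this description, so no formula for [f] is involved. *)
Lemma half_plane_image f g (S : set (uhp R)) :
  (forall z w, qd (f z) (f w) = qd z w) -> f \o g = id -> g \o f = id ->
  half_plane S -> half_plane (f @` S).
Proof.
move=> fi fg gf /half_plane_side_eqn [[L s] ->].
have fgE z : f (g z) = z by rewrite -[LHS]/((f \o g) z) fg.
have gfE z : g (f z) = z by rewrite -[LHS]/((g \o f) z) gf.
have [a [b [d [disc E]]]] := side_eqn_aff (L, s).
have [p hp0] : exists p, 0 < side_eqn (L, s) p.
  by have [p hp0] := aff_ex disc; exists p; rewrite E.
have pn : geodesic_eqn L p != 0 by rewrite -(side_eqn_eq0 (L, s)) gt_eqF.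
have Hbis : [set z | 0 <= side_eqn (L, s) z] = [set z | qd p z <= qd (refl L p) z].
  apply/seteqP; split=> z /=; rewrite [qd p z]qdC [qd (refl _ _) z]qdC qd_refl_le;
    move: hp0; rewrite /side_eqn; case: (s); rewrite /= ?expr1 ?expr0; nra.
rewrite Hbis.
have -> : f @` [set z | qd p z <= qd (refl L p) z] =
          [set z | qd (f p) z <= qd (f (refl L p)) z].
  apply/seteqP; split=> [_ [z /= h <-]|z /= h]; first by rewrite !fi.
  by exists (g z) => //; rewrite /= -fi fgE -[qd (refl _ _) _]fi fgE.
apply: half_plane_bisector => /(congr1 g); rewrite !gfE.
exact: refl_ne.
Qed.

Lemma refl_half_plane L (S : set (uhp R)) : half_plane S -> half_plane (refl L @` S).
Proof.
have rr : @refl R L \o refl L = id by apply/funext => z; exact: reflK.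
apply: (half_plane_image _ rr rr) => z w; by apply: (mobius_qd _ _ _ (mobius_refl L)); rewrite sqrrN expr1n.
Qed.

Lemma polygon_of_triple n (C : 'I_n -> geodesic R * bool) : exists a b c : 'I_n -> R,
  (forall i, 0 < b i ^+ 2 - 4 * a i * c i) /\ polygon_of C = triple_cut a b c.
Proof.
have /choice [t ht] : forall i, exists t : R * R * R,
   0 < t.1.2 ^+ 2 - 4 * t.1.1 * t.2 /\ forall z, side_eqn (C i) z = aff t.1.1 t.1.2 t.2 z.
  by move=> i; have [a [b [d ?]]] := side_eqn_aff (C i); exists (a, b, d).
exists (fun i => (t i).1.1), (fun i => (t i).1.2), (fun i => (t i).2).
split; first by move=> i; case: (ht i).
by apply/seteqP; split=> z h i; have := h i; case: (ht i) => _ ->.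
Qed.

Lemma triple_cut_mirror n (a b c : 'I_n -> R) z :
  triple_cut a (fun i => - b i) c z <-> triple_cut a b c (refl (Vertical 0) z).
Proof.
have E i : aff (a i) (- b i) (c i) z = aff (a i) (b i) (c i) (refl (Vertical 0) z).
  by rewrite /aff /=; ring.
by split=> h i; have := h i; rewrite E.
Qed.

Lemma triple_cut_mirror_half_plane n (a b c : 'I_n -> R) :
  (forall H, half_plane H -> ~ (H `<=` triple_cut a b c)) ->
  (forall H, half_plane H -> ~ (H `<=` triple_cut a (fun i => - b i) c)).
Proof.
move=> noH H hH sub; apply: (noH (refl (Vertical 0) @` H)).
  exact: refl_half_plane.
by move=> _ [z Hz <-]; apply/triple_cut_mirror; exact: sub.
Qed.

(** With [h = |Re z - x|], the bounds [h <= (K1 + K2) y^2] and [h < 1] add up to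
    [h (1 + y^2) <= (K1 + K2 + 1) y^2]. The denominator keeps the area density integrable at large
    heights too. *)
Lemma polygon_of_local n (C : 'I_n -> geodesic R * bool) x :
  (forall H, half_plane H -> ~ (H `<=` polygon_of C)) ->
  exists e K : R, [/\ 0 < e, 0 < K & forall z, polygon_of C z -> `|reh z - x| < e ->
     `|reh z - x| <= K * imh z ^+ 2 / (1 + imh z ^+ 2)].
Proof.
have [a [b [c [disc ->]]]] := polygon_of_triple C => noH.
have [e1 [K1 [e10 K10 h1]]] := triple_cut_right x disc noH.
have disc' i : 0 < (- b i) ^+ 2 - 4 * a i * c i by rewrite sqrrN.
have [e2 [K2 [e20 K20 h2]]] :=
  triple_cut_right (- x) disc' (triple_cut_mirror_half_plane noH).
exists (Num.min 1 (Num.min e1 e2)), (K1 + K2 + 1); split.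
- by rewrite !lt_min ltr01 e10 e20.
- by rewrite !addr_gt0.
move=> z hz; rewrite !lt_min => /andP[l1 /andP[le1 le2]].
have y2 : 0 < imh z ^+ 2 by rewrite exprn_gt0 // imh_gt0.
have D : 0 < 1 + imh z ^+ 2 by rewrite addr_gt0.
rewrite ler_pdivlMr //.
have : `|reh z - x| <= (K1 + K2) * imh z ^+ 2; last first.
  have : `|reh z - x| * imh z ^+ 2 <= 1 * imh z ^+ 2 by rewrite ler_pM2r // ltW.
  lra.
have [E|] := eqVneq (reh z) x.
  by rewrite E subrr normr0 mulr_ge0 ?addr_ge0 // ltW.
rewrite neq_lt => /orP[p|p].
- have E : `|reh z - x| = reh (refl (Vertical 0) z) - - x.
    rewrite ltr0_norm ?subr_lt0 //=; ring.
  have m : triple_cut a (fun i => - b i) c (refl (Vertical 0) z).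
    by apply/triple_cut_mirror; rewrite reflK.
  have : `|reh z - x| <= K2 * imh z ^+ 2.
    rewrite E; apply: (h2 _ m); rewrite -E le2 andbT normr_gt0 subr_eq0 lt_eqF //.
  have : 0 <= K1 * imh z ^+ 2 by rewrite mulr_ge0 // ltW.
  lra.
- have E : `|reh z - x| = reh z - x by rewrite gtr0_norm // subr_gt0.
  have : `|reh z - x| <= K1 * imh z ^+ 2.
    by rewrite E; apply: (h1 _ hz); rewrite -{2}E le1 andbT subr_gt0.
  have : 0 <= K2 * imh z ^+ 2 by rewrite mulr_ge0 // ltW.
  lra.
Qed.

Lemma polygon_of_bounded n (C : 'I_n -> geodesic R * bool) :
  (forall H, half_plane H -> ~ (H `<=` polygon_of C)) ->
  exists M : R, forall z, polygon_of C z -> `|reh z| <= M.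
Proof.
have [a [b [c [disc ->]]]] := polygon_of_triple C => noH.
have [M1 h1] := triple_cut_right_infty disc noH.
have disc' i : 0 < (- b i) ^+ 2 - 4 * a i * c i by rewrite sqrrN.
have [M2 h2] := triple_cut_right_infty disc' (triple_cut_mirror_half_plane noH).
exists (Num.max M1 M2) => z hz; rewrite ler_norml; apply/andP; split.
  have : triple_cut a (fun i => - b i) c (refl (Vertical 0) z).
    by apply/triple_cut_mirror; rewrite reflK.
  move=> /h2 /=; rewrite mulr0 sub0r => ?; rewrite lerNl le_max; apply/orP; right.
  by [].
by rewrite le_max h1.
Qed.

Lemma half_plane_box (S : set (uhp R)) : half_plane S ->
  exists l r e : R, [/\ l < r, 0 < e &
    forall z, l <= reh z <= r -> imh z <= e -> S z].
Proof.
move=> [L [->|->]]; case: L => [x|x r].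
- exists x, (x + 1), 1; split=> //; first by lra.
  by move=> z /andP[? ?] _; rewrite /side_pos /= subr_ge0.
- have r0 : 0 < r%:num by [].
  exists (x + r%:num), (x + r%:num + 1), 1; split=> //; first by lra.
  move=> z /andP[h1 h2] _; rewrite /side_pos /=.
  have := sqr_ge0 (imh z); nra.
- exists (x - 1), x, 1; split=> //; first by lra.
  by move=> z /andP[? ?] _; rewrite /side_neg /= subr_le0.
- have r0 : 0 < r%:num by [].
  exists x, (x + r%:num / 2), (r%:num / 2); split=> //; first by lra.
    move=> z /andP[h1 h2] h3; rewrite /side_neg /=; have y0 := imh_gt0 z.
  nra.
Qed.

End IdealBoundary.

(** * Area *)

Section Area.
Variable R : realType.
Implicit Types (z w p : uhp R) (Q : set (uhp R)).
Local Notation mu := (@lebesgue_measure R).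
Local Notation T2 := (measurableTypeR R * measurableTypeR R)%type.
Local Notation D0 := [set u : R * R | 0 < u.2].

Lemma measurable_upper : measurable (D0 : set T2).
Proof.
have -> : D0 = snd @^-1` `]0, +oo[%classic.
  by apply/seteqP; split=> u /=; rewrite in_itv /= andbT.
rewrite -[X in measurable X]setTI.
by apply: (measurable_snd : measurable_fun setT (snd : T2 -> measurableTypeR R)).
Qed.

Lemma measurable_density (D : set T2) : measurable D -> D `<=` D0 ->
  measurable_fun D (fun u : T2 => (u.2 ^- 2)%:E : \bar R).
Proof.
move=> mD DD0; apply/measurable_EFinP.
apply: (@measurable_funS _ _ _ _ D0) => //; first exact: measurable_upper.
apply: (eq_measurable_fun (fun u : T2 => (u.2^-1 ^+ 2 : R))).
  by move=> u _ /=; rewrite exprVn.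
apply: measurable_funX.
have := @measurable_comp _ _ _ T2 (measurableTypeR R) (measurableTypeR R) `]0, +oo[%classic (fun x : R => x^-1) D0 (snd : T2 -> R).
apply.
- exact: measurable_itv.
- by move=> _ [u u0 <-] /=; rewrite in_itv /= andbT.
- apply: subspace_continuous_measurable_fun => //.
  apply: continuous_in_subspaceT => x; rewrite inE /= in_itv /= andbT => x0.
  by apply: inv_continuous; rewrite gt_eqF.
- by apply: measurable_funTS; exact: measurable_snd.
Qed.

Lemma density_ge0 (u : R * R) : (0 <= (u.2 ^- 2)%:E)%E.
Proof. by rewrite lee_fin invr_ge0 sqr_ge0. Qed.

Lemma measurable_polygon_of n (C : 'I_n -> geodesic R * bool) :
  measurable (@ucoord R @` polygon_of C : set T2).
Proof.
have [a [b [c [_ ->]]]] := polygon_of_triple C.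
have -> : @ucoord R @` triple_cut a b c = D0 `&` \bigcap_(i in [set: 'I_n])
    [set u : R * R | 0 <= a i + b i * u.1 + c i * (u.1 ^+ 2 + u.2 ^+ 2)].
  apply/seteqP; split=> [_ [z hz <-]|[x y] [/= y0 h]].
    by split=> [|i _]; [exact: imh_gt0|exact: hz].
  by exists (uhp_of x y0) => // i; exact: h.
apply: measurableI; first exact: measurable_upper.
apply: fin_bigcap_measurable => // i _.
rewrite -[X in measurable X]setTI.
have m1 : measurable_fun [set: T2] (fst : T2 -> R) by exact: measurable_fst.
have m2 : measurable_fun [set: T2] (snd : T2 -> R) by exact: measurable_snd.
apply: (@measurable_fun_le _ _ _ _ (cst 0) (fun u : T2 => a i + b i * u.1 + c i * (u.1 ^+ 2 + u.2 ^+ 2))) => //.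
apply: measurable_funD; first by apply: measurable_funD => //; apply: measurable_funM.
by apply: measurable_funM => //; apply: measurable_funD; apply: measurable_funX.
Qed.

Definition finite_area (D : set T2) := [/\ measurable D, D `<=` D0
  & (\int[mu \x mu]_(u in D) (u.2 ^- 2)%:E < +oo)%E].

Lemma finite_areaU (A B : set T2) : finite_area A -> finite_area B -> finite_area (A `|` B).
Proof.
move=> [mA A0 fA] [mB B0 fB]; split; first exact: measurableU.
  by move=> u [/A0|/B0].
rewrite (_ : A `|` B = A `|` (B `\` A)); last first.
  by apply/seteqP; split=> u; [move=> [?|?]; [left|have [?|?] := pselect (A u); [left|right]]|
    move=> [?|[? _]]; [left|right]].
have mBA : measurable (B `\` A) by exact: measurableD.
rewrite ge0_integral_setU //; last 3 first.
- by apply: measurable_density; [exact: measurableU|move=> u [/A0|[/B0]]].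
- by move=> u _; exact: density_ge0.
- by apply/disj_setPS => u [? []].
rewrite lte_add_pinfty //; apply: le_lt_trans fB.
apply: ge0_subset_integral => //; first exact: measurable_density.
by move=> u _; exact: density_ge0.
Qed.

Lemma finite_areaS (A B : set T2) : measurable A -> A `<=` B -> finite_area B -> finite_area A.
Proof.
move=> mA AB [mB B0 fB]; split=> //; first by move=> u /AB /B0.
apply: le_lt_trans fB; apply: ge0_subset_integral => //; first exact: measurable_density.
by move=> u _; exact: density_ge0.
Qed.

Lemma finite_area_bigcup (I : choiceType) (s : seq I) (F : I -> set T2) (A : set T2) :
  (forall i, finite_area (F i)) -> measurable A ->
  (forall u, A u -> exists2 i, i \in s & F i u) -> finite_area A.
Proof.
move=> fF mA cov; apply: (@finite_areaS _ (\big[setU/set0]_(i <- s) F i)) => //.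
  by move=> u /cov [i si Fi]; rewrite -bigcup_seq; exists i.
elim: s {cov} => [|i s IH]; last by rewrite big_cons; exact: finite_areaU.
by rewrite big_nil; split=> //; rewrite integral_set0 ltry.
Qed.

(* The fibre at height [y] has length [2 K y^2 / (1 + y^2)], so the area is the
   integral of [2 K / (1 + y^2)]. *)
Definition cusp (x K : R) : set T2 :=
  [set u | 0 < u.2 /\ `|u.1 - x| <= K * u.2 ^+ 2 / (1 + u.2 ^+ 2)].

Lemma measurable_cusp x K : measurable (cusp x K).
Proof.
have -> : cusp x K = D0 `&` [set u : T2 | `|u.1 - x| * (1 + u.2 ^+ 2) <= K * u.2 ^+ 2].
  apply/seteqP; split=> u [/= u0 h]; split=> //=.
    by rewrite -ler_pdivlMr // ltr_pwDl // sqr_ge0.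
  by rewrite ler_pdivlMr // ltr_pwDl // sqr_ge0.
apply: measurableI; first exact: measurable_upper.
rewrite -[X in measurable X]setTI.
have m1 : measurable_fun [set: T2] (fst : T2 -> R) by exact: measurable_fst.
have m2 : measurable_fun [set: T2] (snd : T2 -> R) by exact: measurable_snd.
apply: (@measurable_fun_le _ _ _ _ (fun u : T2 => `|u.1 - x| * (1 + u.2 ^+ 2)) (fun u : T2 => K * u.2 ^+ 2)) => //.
  apply: measurable_funM.
    by apply: measurableT_comp => //; apply: measurable_funB.
  by apply: measurable_funD => //; apply: measurable_funX.
by apply: measurable_funM => //; apply: measurable_funX.
Qed.

Lemma cusp_finite_area x K : 0 <= K -> finite_area (cusp x K).
Proof.
move=> K0; have mC := measurable_cusp x K.
have C0 : cusp x K `<=` D0 by move=> u [].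
split=> //; rewrite integral_mkcond.
have mf : measurable_fun [set: T2] ((fun u : T2 => (u.2 ^- 2)%:E) \_ (cusp x K)).
  by apply/(measurable_restrictT _ _).1 => //; exact: measurable_density.
have f0 (u : T2) : (0 <= ((fun u : T2 => (u.2 ^- 2)%:E) \_ (cusp x K)) u)%E.
  by apply: erestrict_ge0 => v _; exact: density_ge0.
rewrite (fubini_tonelli2 _ mf f0).
pose k (y : R) := K * y ^+ 2 / (1 + y ^+ 2).
have inner y : fubini_G mu ((fun u : T2 => (u.2 ^- 2)%:E) \_ (cusp x K)) y =
   (((fun t : R => (2 * K)%:E * ((oneDsqr t)^-1)%:E) \_ `]0%R, +oo[) y)%E.
  rewrite /fubini_G [RHS]patchE mem_setE in_itv /= andbT.
  have [y0|y0] := ltP 0 y; last first.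
    apply: integral0_eq => t _; rewrite patchE; case: ifPn => // /set_mem [/=].
    by rewrite ltNge y0.
  pose I : set R := `[x - k y, x + k y]%classic.
  transitivity (\int[mu]_t (((fun=> (y ^- 2)%:E : \bar R) \_ I) t))%E.
    apply: eq_integral => t _; rewrite !patchE; congr (if _ then _ else _).
    apply/idP/idP => /set_mem h; apply/mem_set.
      case: h => _; rewrite /= ler_norml -/(k y) => /andP[? ?].
      by rewrite /I /= in_itv /=; apply/andP; split; lra.
    move: h; rewrite /I /= in_itv /= => /andP[? ?].
    by split=> //=; rewrite ler_norml -/(k y); apply/andP; split; lra.
  have -> : (\int[mu]_t (((fun=> (y ^- 2)%:E : \bar R) \_ I) t) = (y ^- 2)%:E * mu I)%E.
    by rewrite -integral_mkcond integral_cst //; exact: measurable_itv.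
  rewrite /I lebesgue_measure_itv /= lte_fin.
  have D : 0 < 1 + y ^+ 2 by rewrite ltr_pwDl // sqr_ge0.
  have k0 : 0 <= k y by rewrite /k mulr_ge0 ?invr_ge0 ?(ltW D) // mulr_ge0 // sqr_ge0.
  have kE : y ^- 2 * (2 * k y) = 2 * K * (oneDsqr y)^-1.
    by rewrite /k /oneDsqr; field; rewrite !gt_eqF.
  have [lt|ge] := ltP (x - k y) (x + k y).
    by rewrite -EFinB -!EFinM -kE; congr (_ * _)%:E; ring.
  have {}k0 : k y = 0 by lra.
  by rewrite mule0 -EFinM -kE k0 !mulr0.
under eq_integral do rewrite inner.
rewrite -integral_mkcond.
have moD : measurable_fun [set: R] (fun t : R => ((oneDsqr t)^-1)%:E).
  by apply/measurable_EFinP; apply: continuous_measurable_fun; exact: continuous_oneDsqrV.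
have o0 (t : R) : (0 <= ((oneDsqr t)^-1)%:E)%E.
  by rewrite lee_fin invr_ge0 addr_ge0 // sqr_ge0.
(* The range is enlarged by the point 0 to meet the arctangent integral over the closed ray. *)
apply: (@le_lt_trans _ _ (\int[mu]_(t in `[0%R, +oo[) ((2 * K)%:E * ((oneDsqr t)^-1)%:E))%E).
  apply: ge0_subset_integral => //.
  - by apply: measurable_funeM; exact: measurable_funTS.
  - by move=> t _; rewrite mule_ge0 // lee_fin mulr_ge0.
  - by move=> t; rewrite /= !in_itv /= !andbT; exact: ltW.
rewrite ge0_integralZl //; first last.
- by rewrite lee_fin mulr_ge0.
- exact: measurable_funTS.
by rewrite integral0y_oneDsqr -EFinM ltry.
Qed.

(** The real parts are bounded, and over a neighbourhood of each boundary point the polygon lies in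
    a cusp; by compactness finitely many cusps cover it. *)
Lemma polygon_of_finite_area n (C : 'I_n -> geodesic R * bool) :
  (forall H, half_plane H -> ~ (H `<=` polygon_of C)) -> (harea (polygon_of C) < +oo)%E.
Proof.
move=> noH; have [M hM] := polygon_of_bounded noH.
have /choice [eK heK] : forall x, exists eK : R * R, [/\ 0 < eK.1, 0 < eK.2 & forall z, polygon_of C z ->
  `|reh z - x| < eK.1 -> `|reh z - x| <= eK.2 * imh z ^+ 2 / (1 + imh z ^+ 2)].
  by move=> x; have [e [K h]] := polygon_of_local x noH; exists (e, K).
have := @segment_compact R (- M) M; rewrite compact_cover.
move=> /(_ R [set: R] (fun x => ball x (eK x).1)) [].
- by move=> x _; exact: ball_open.
- by move=> x _; exists x => //; apply: ballxx; case: (heK x).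
move=> s _ cov.
suff [_ _] : finite_area (@ucoord R @` polygon_of C) by [].
apply: (@finite_area_bigcup _ (finmap.enum_fset s) (fun x => cusp x (eK x).2)).
- by move=> x; apply: cusp_finite_area; case: (heK x) => _ /ltW.
- exact: measurable_polygon_of.
move=> _ [z Cz <-]; have : `[- M, M]%classic (reh z).
  by have := hM z Cz; rewrite ler_norml /= in_itv.
move=> /cov [x xs]; rewrite /ball /= distrC => hx; exists x => //.
by split; [exact: imh_gt0|case: (heK x) => _ _; apply].
Qed.

(** Over a boundary interval [[l, r]] the layer [d / 2 <= y <= d] has area at least
    [(r - l) / (2 d)], unbounded as [d] tends to 0. *)
Lemma half_plane_infinite_area n (C : 'I_n -> geodesic R * bool) H :
  half_plane H -> H `<=` polygon_of C -> harea (polygon_of C) = +oo%E.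
Proof.
move=> /half_plane_box [l [r [e [lr e0 box]]]] HC.
have mQ := measurable_polygon_of C.
have Q0 : @ucoord R @` polygon_of C `<=` D0 by move=> _ [z _ <-]; exact: imh_gt0.
have bound (d : R) : 0 < d <= e -> (((r - l) / (2 * d))%:E <= harea (polygon_of C))%E.
  move=> /andP[d0 de].
  pose I1 : set R := `[l, r]%classic; pose I2 : set R := `[d / 2, d]%classic.
  pose B : set T2 := I1 `*` I2.
  have mB : measurable B by apply: measurableX; exact: measurable_itv.
  have BQ : B `<=` @ucoord R @` polygon_of C.
    move=> [x y] [/= ]; rewrite /I1 /I2 /= !in_itv /= => hx /andP[y1 y2].
    have y0 : 0 < y by lra.
    exists (uhp_of x y0) => //; apply: HC; apply: box => //=.
    exact: le_trans y2 de.
  apply: (@le_trans _ _ (\int[mu \x mu]_(u in B) (u.2 ^- 2)%:E)%E); last first.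
    apply: ge0_subset_integral => //; first exact: measurable_density.
    by move=> u _; exact: density_ge0.
  apply: (@le_trans _ _ (\int[mu \x mu]_(u in B) (cst (d ^- 2)%:E u))%E); last first.
    apply: ge0_le_integral => //.
    - by move=> u _; rewrite lee_fin invr_ge0 sqr_ge0.
    - by apply: measurable_density => // u /BQ /Q0.
    move=> u [_ /=]; rewrite /I2 /= in_itv /= => /andP[y1 y2].
    have y0 : 0 < u.2 by lra.
    by rewrite lee_fin lef_pV2 ?posrE ?exprn_gt0 // ler_sqr ?nnegrE // ltW.
  have -> : (\int[mu \x mu]_(u in B) (cst (d ^- 2)%:E u) =
      (d ^- 2)%:E * (mu I1 * mu I2))%E.
    by rewrite integral_cst //; congr (_ * _)%E; apply: product_measure1E => //; exact: measurable_itv.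
  rewrite /I1 /I2 !lebesgue_measure_itv /= !lte_fin lr.
  rewrite ifT; last by lra.
  rewrite -!EFinB -!EFinM lee_fin.
  have -> : d ^- 2 * ((r - l) * (d - d / 2)) = (r - l) / (2 * d) by field; rewrite gt_eqF.
  by [].
have h0 : (0 <= harea (polygon_of C))%E by apply: integral_ge0 => u _; exact: density_ge0.
case E : (harea (polygon_of C)) h0 => [A| |] // A0; exfalso; rewrite lee_fin in A0.
have lr0 : 0 < r - l by rewrite subr_gt0.
pose d := Num.min e ((r - l) / (2 * (A + 1))).
have A1 : 0 < 2 * (A + 1) by lra.
have d0 : 0 < d by rewrite lt_min e0 divr_gt0.
have de : d <= e by rewrite ge_min lexx.
have := bound d; rewrite d0 de E lee_fin => /(_ isT).
have : d <= (r - l) / (2 * (A + 1)) by rewrite ge_min lexx orbT.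
rewrite ler_pdivlMr // => h1; rewrite ler_pdivrMr; last by rewrite mulr_gt0.
nra.
Qed.

Lemma polygon_of_no_half_plane n (C : 'I_n -> geodesic R * bool) :
  (harea (polygon_of C) < +oo)%E -> forall H, half_plane H -> ~ (H `<=` polygon_of C).
Proof.
by move=> fin H hH HC; move: fin; rewrite (half_plane_infinite_area hH HC) ltxx.
Qed.

Lemma harea_setU_fin n m (C : 'I_n -> geodesic R * bool) (C' : 'I_m -> geodesic R * bool) :
  (harea (polygon_of C) < +oo)%E -> (harea (polygon_of C') < +oo)%E ->
  forall k (C2 : 'I_k -> geodesic R * bool), polygon_of C2 `<=` polygon_of C `|` polygon_of C' ->
  (harea (polygon_of C2) < +oo)%E.
Proof.
have sub l (D : 'I_l -> geodesic R * bool) : @ucoord R @` polygon_of D `<=` D0.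
  by move=> _ [z _ <-]; exact: imh_gt0.
move=> f1 f2 k C2 h.
have F1 : finite_area (@ucoord R @` polygon_of C) by split; [exact: measurable_polygon_of|exact: sub|].
have F2 : finite_area (@ucoord R @` polygon_of C') by split; [exact: measurable_polygon_of|exact: sub|].
suff [] : finite_area (@ucoord R @` polygon_of C2) by [].
apply: finite_areaS (finite_areaU F1 F2); first exact: measurable_polygon_of.
by move=> _ [z /h [] hz <-]; [left|right]; exists z.
Qed.

End Area.

(** * The doubled polygon *)

Section FundamentalDomain.
Variables (R : realType) (Q : set (uhp R)) (G : set (uhp R -> uhp R)).
Hypothesis hG : discrete_reflection_group Q G.
Implicit Types (z w p : uhp R) (f g h : uhp R -> uhp R).

Definition rotations : set (uhp R -> uhp R) := [set g | G g /\ mobius 1 g].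

Lemma refl_eqn L z : exists2 k : R, 0 < k &
  geodesic_eqn L (refl L z) = - k * geodesic_eqn L z.
Proof.
case: L => [x|x r] /=; first by exists 1 => //; ring.
have D0 := sqrD_gt0 z x; exists (r%:num ^+ 2 / ((reh z - x) ^+ 2 + imh z ^+ 2)).
  by rewrite divr_gt0 // exprn_gt0.
by field; rewrite gt_eqF.
Qed.

Lemma polygon_of_polygon n (C : 'I_n -> geodesic R * bool) :
  (polygon_of C)° !=set0 -> (harea (polygon_of C) < +oo)%E -> polygon (polygon_of C).
Proof.
move=> h0 hA; split=> //; exists n, (fun i => [set z | 0 <= side_eqn (C i) z]); split.
  by move=> i; apply/half_plane_side_eqn; exists (C i).
by apply/seteqP; split=> z h i; [move=> _|]; exact: h.
Qed.

Lemma half_planes_polygon_of n (S : 'I_n -> set (uhp R)) : (forall i, half_plane (S i)) ->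
  exists C : 'I_n -> geodesic R * bool, polygon_of C = [set z | forall i, S i z].
Proof.
move=> hS; have /choice [C hC] : forall i, exists c, S i = [set z | 0 <= side_eqn c z].
  by move=> i; apply/half_plane_side_eqn.
by exists C; apply/seteqP; split=> z h i; have := h i; rewrite hC.
Qed.

Let sK L : refl L \o refl L = @id (uhp R).
Proof. by apply/funext => z; exact: reflK. Qed.

Let s1 : (1 : R) ^+ 2 = 1. Proof. by rewrite expr1n. Qed.
Let sN1 : (-1 : R) ^+ 2 = 1. Proof. by rewrite sqrrN expr1n. Qed.

Lemma rotations_sub : rotations `<=` G. Proof. by move=> g []. Qed.

Lemma rotations_group : is_group rotations.
Proof.
have [Gid Gcomp Ginv] := refl_group_group hG; split.
- by split=> //; exact: mobius_id.
- move=> f g [Gf hf] [Gg hg]; split; first exact: Gcomp.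
  by have := mobius_comp s1 s1 hf hg; rewrite mulr1.
move=> f [Gf hf]; have [g Gg [fg gf]] := Ginv f Gf; exists g => //; split=> //.
have [g' [hg' fg' gf']] := mobius_inv s1 hf.
suff -> : g = g' by [].
by rewrite -[g]/(id \o g) -gf' -compA fg.
Qed.

Lemma rotations_fuchsian : fuchsian rotations.
Proof.
split; first exact: rotations_group.
  by move=> g [_ /mobius_preservingP].
have sub : matrix_lifts rotations `<=` matrix_lifts G.
  by move=> A [f [Gf _] hf]; exists f.
move=> A hA; have [_ _ + _] := hG => /(_ A (sub A hA)) [_ [V nV VA]].
split; first exact: mem_set.
exists V => //; apply/seteqP; split=> B.
  by move=> [VB /sub hB]; rewrite -VA.
by move=> ->; split=> //; exact: nbhs_singleton.
Qed.

Section Doubling.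
Variables (n : nat) (C : 'I_n -> geodesic R * bool) (L : geodesic R).
Hypothesis EQ : Q = polygon_of C.
Hypothesis bC : forall i, bears_side Q (C i).1.
Hypothesis bL : bears_side Q L.

Definition doubled : set (uhp R) := Q `|` refl L @` Q.

Lemma refl_group_coset g : G g -> mobius 1 g \/ mobius 1 (g \o refl L).
Proof.
move=> /(refl_group_isom hG) [|h]; [by left|right].
by have := mobius_comp sN1 sN1 h (mobius_refl L); rewrite mulrNN mulr1.
Qed.

Lemma index_two_rotations : index_two_subgroup rotations G.
Proof.
have [Gid Gcomp Ginv] := refl_group_group hG; have Gs := refl_group_refl hG bL.
split; [exact: rotations_group|exact: (refl_group_group hG)|exact: rotations_sub|].
pose N : set (uhp R -> uhp R) := [set g | G g /\ mobius (-1) g].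
have cosetE e g : e ^+ 2 = 1 -> G g -> mobius e g ->
    [set g \o h | h in rotations] = [set k | G k /\ mobius e k].
  move=> he Gg hg; apply/seteqP; split=> [_ [h [Gh hh] <-]|k [Gk hk]].
    split; first exact: Gcomp.
    by have := mobius_comp he s1 hg hh; rewrite mulr1.
  have [g' [hg' gg' g'g]] := mobius_inv he hg.
  have [g2 Gg2 [gg2 g2g]] := Ginv g Gg.
  have E : g2 = g' by rewrite -[g2]/(id \o g2) -g'g -compA gg2.
  exists (g' \o k); last by rewrite compA gg'.
  split; first by rewrite -E; exact: Gcomp.
  by have := mobius_comp he he hg' hk; rewrite -expr2 he.
have -> : [set [set g \o h | h in rotations] | g in G] =
    (fun k : nat => if k == 0%N then rotations else N) @` `I_2.
  apply/seteqP; split.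
    move=> _ [g Gg <-]; case: (refl_group_isom hG Gg) => hg.
      by exists 0%N => //=; rewrite (cosetE 1).
    by exists 1%N => //=; rewrite (cosetE (-1)).
  move=> _ [[|[|k]] //= _ <-].
    by exists id => //; rewrite (cosetE 1) //; exact: mobius_id.
  by exists (refl L) => //; rewrite (cosetE (-1)) //; exact: mobius_refl.
apply: inj_card_eq => i j; rewrite !inE /=.
have RN : rotations <> N.
  move=> E; have : rotations id by split=> //; exact: mobius_id.
  by rewrite {1}E => -[_]; exact: (mobius_sign (@mobius_id R)).
by case: i j => [|[|i]] [|[|j]] //= _ _ E; first [case: (RN E) | case: (RN (esym E))].
Qed.

Lemma doubled_covers : covers rotations doubled.
Proof.
have Gs := refl_group_refl hG bL.
have [_ _ _ [cov _]] := hG; apply/seteqP; split=> // z _.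
have : setT z by []. rewrite -cov => -[g Gg [y Qy <-]].
have [hg|hg] := refl_group_coset Gg; first by exists g => //; exists y => //; left.
exists (g \o refl L); first by split=> //; exact: (refl_group_comp hG).
by exists (refl L y); [right; exists y|rewrite /= reflK].
Qed.

(** An interior point of [doubled] may lie on [L], in the interior of neither tile; the tessellation
    has to be applied to a nearby point instead. *)
Lemma doubled_near w U : nbhs w U -> doubled w ->
  exists h v, [/\ h = id \/ h = refl L, Q° v & U (h v)].
Proof.
have Gs := refl_group_refl hG bL.
have [[_ [p Qp] _] _ _ _] := hG.
move=> nU [Qw|[v Qv E]].
  rewrite EQ in Qp Qw *; have [v Uv Qv] := polygon_of_dense Qp Qw nU.
  by exists id, v; split=> //; left.
have nV : nbhs v (refl L @` U).
  suff : (refl L @` U)° v by [].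
  by rewrite -(refl_group_interior hG _ Gs); exists w => //; rewrite -E reflK.
rewrite EQ in Qp Qv *; have [u [w' Uw' <-] Qu] := polygon_of_dense Qp Qv nV.
by exists (refl L), (refl L w'); split=> //; [right|rewrite reflK].
Qed.

(** A common interior point gives [h = g \o h'] with [h] and [h'] among [id] and [refl L]. If they
    agree, [g] is the identity; if not, orientation is contradicted. *)
Lemma doubled_disjoint g : rotations g -> g <> id -> doubled° `&` (g @` doubled°) = set0.
Proof.
move=> [Gg hg] gid; have Gs := refl_group_refl hG bL; have [Gid Gcomp _] := refl_group_group hG.
apply/seteqP; split=> // w [Pw gPw].
have nU : nbhs w (g @` doubled).
  suff : (g @` doubled)° w by [].
  by rewrite -(refl_group_interior hG _ Gg).
have [h [v [hh Qv [u Pu E]]]] := doubled_near nU (interior_subset Pw).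
have Gh : G h by case: hh => ->.
have [h' [u' [hh' Qu' Eu]]] : exists h' u', [/\ h' = id \/ h' = refl L, Q u' & u = h' u'].
  by case: Pu => [Qu|[u' Qu' <-]]; [exists id, u; split=> //; left|exists (refl L), u'; split=> //; right].
have Gh' : G h' by case: hh' => ->.
have Eh : h = g \o h'.
  by apply: (refl_group_eq_near hG Gh (Gcomp _ _ Gg Gh') Qv Qu'); rewrite /= -Eu.
case: hh => Hh; case: hh' => Hh'; rewrite {}Hh {}Hh' in Eh.
- by apply: gid; rewrite Eh.
- apply: (mobius_sign (@mobius_id R)); rewrite Eh.
  by have := mobius_comp s1 sN1 hg (mobius_refl L); rewrite mul1r.
- apply: (mobius_sign hg); have -> : g = refl L by rewrite Eh.
  exact: mobius_refl.
- by apply: gid; rewrite -[g]/(g \o id) -(sK L) compA -Eh sK.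
Qed.

Variable z0 : uhp R.
Hypothesis Qz0 : Q z0.
Hypothesis Lz0 : geodesic_eqn L z0 = 0.
Hypothesis Cz0 : forall i, (C i).1 = L \/ 0 < side_eqn (C i) z0.

Lemma doubled_closest x g : doubled x -> G g -> qd x z0 <= qd x (g z0).
Proof.
have Gs := refl_group_refl hG bL; move=> [Qx|[y Qy <-]] Gg; first exact: (refl_group_min hG).
rewrite -{1}(refl_fix Lz0) (refl_group_qd hG _ _ Gs) -[g z0](reflK L) (refl_group_qd hG _ _ Gs).
exact: (refl_group_min hG Qy Qz0 (refl_group_comp hG Gs Gg)).
Qed.

(** Either [x] or its mirror image lies on the same side of [L] as [Q]; the inequalities for the
    reflected centres, or for their images under [refl L], place that point inside all other
    sides. *)
Lemma closest_doubled x :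
  (forall i, (C i).1 <> L -> qd x z0 <= qd x (refl (C i).1 z0) /\
     qd x z0 <= qd x (refl L (refl (C i).1 z0))) -> doubled x.
Proof.
move=> H; have Gs := refl_group_refl hG bL.
have [c [cL Qc]] : exists c, c.1 = L /\ Q `<=` [set z | 0 <= side_eqn c z].
  have [[h|h] _] := bL; [exists (L, false)|exists (L, true)]; split=> // z /h;
    rewrite /side_pos /side_neg /side_eqn /= ?expr0 ?expr1 ?mul1r ?mulN1r ?oppr_ge0 //.
have [[_ [p Qp] _] _ _ _] := hG.
have key y : 0 <= side_eqn c y -> (forall i, (C i).1 <> L -> qd y z0 <= qd y (refl (C i).1 z0)) -> Q y.
  move=> cy Hy; rewrite EQ => i; have [iL|hi] := Cz0 i.
    have pi : 0 < side_eqn (C i) p by apply: interior_polygon_of; rewrite -EQ.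
    have pc : 0 < side_eqn c p := side_eqn_interior Qc Qp.
    (* A listed side lying on [L] bounds the same half-plane as [c], because both functions are
       positive at the interior point [p]. *)
    have -> : C i = c.
      case: (C i) c iL cL pi pc {Qc cy} => [L1 s1'] [L2 s2] /= -> ->.
      by case: s1'; case: s2 => //; rewrite /side_eqn /= expr0 expr1 => ? ?; exfalso; lra.
    exact: cy.
  have [iL|iL] := pselect ((C i).1 = L).
    by move: hi; rewrite lt_def side_eqn_eq0 iL Lz0 eqxx.
  have := Hy i iL; rewrite qd_refl_le; move: hi; rewrite /side_eqn.
  by case: (C i).2; rewrite /= ?expr1 ?expr0 => ? ?; nra.
have [cx|cx] := leP 0 (side_eqn c x); [left|right].
  by apply: key => // i /H [].
exists (refl L x); last exact: reflK.
apply: key.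
  have [k k0 E] := refl_eqn L x; move: cx; rewrite /side_eqn cL E.
  by case: c.2; rewrite /= ?expr1 ?expr0 => ?; nra.
move=> i /H [_ h]; rewrite -{1}(refl_fix Lz0) (refl_group_qd hG _ _ Gs).
by rewrite -[X in _ <= X](refl_group_qd hG _ _ Gs) reflK.
Qed.

Lemma doubled_dirichlet : doubled = dirichlet_domain rotations z0.
Proof.
have Gs := refl_group_refl hG bL; have [Gid Gcomp _] := refl_group_group hG.
apply/seteqP; split=> x hx.
  by move=> g [Gg _] _; rewrite hdist_le; exact: doubled_closest.
have H g : G g -> qd x z0 <= qd x (g z0).
  have H1 g' : rotations g' -> qd x z0 <= qd x (g' z0).
    move=> hg'; have [->//|gid] := pselect (g' = id).
    by rewrite -hdist_le; exact: hx.
  move=> Gg; have [hg|hg] := refl_group_coset Gg; first exact: H1.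
  by have := H1 _ (conj (Gcomp _ _ Gg Gs) hg); rewrite /= refl_fix.
apply: closest_doubled => i iL; have Gi := refl_group_refl hG (bC i).
by split; [exact: H|exact: (H _ (Gcomp _ _ Gs Gi))].
Qed.

Lemma doubled_polygon_of : exists m (C2 : 'I_m -> geodesic R * bool), doubled = polygon_of C2.
Proof.
have Gs := refl_group_refl hG bL.
pose J : {set 'I_n} := [set i | `[< (C i).1 <> L >]]%SET.
pose v (j : 'I_#|J|) := @enum_val _ (mem J) j.
have vL j : (C (v j)).1 <> L by have := @enum_valP _ _ j; rewrite finset.inE => /asboolP.
have nz j : geodesic_eqn (C (v j)).1 z0 != 0.
  case: (Cz0 (v j)) => [/vL //|]; by rewrite lt_def side_eqn_eq0 => /andP[].
(* One bisector for each side off [L] and one for its mirror image, hence twice the index set. *)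
pose S (k : 'I_(#|J| + #|J|)) := match fintype.split k with
  | inl j => [set x | qd z0 x <= qd (refl (C (v j)).1 z0) x]
  | inr j => [set x | qd z0 x <= qd (refl L (refl (C (v j)).1 z0)) x] end.
have [k|C2 hC2] := @half_planes_polygon_of _ S.
  rewrite /S; case: (fintype.split k) => j; apply: half_plane_bisector.
    exact: refl_ne.
  rewrite -{1}(refl_fix Lz0) => /(congr1 (refl L)); rewrite !reflK.
  exact: refl_ne.
exists _, C2; rewrite hC2; apply/seteqP; split=> x hx.
  move=> k; rewrite /S; case: (fintype.split k) => j /=; rewrite qdC [qd (refl _ _) _]qdC;
    have Gj := refl_group_refl hG (bC (v j)).
    exact: doubled_closest.
  exact: (doubled_closest hx (refl_group_comp hG Gs Gj)).
apply: closest_doubled => i iL.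
have iJ : i \in J by rewrite finset.inE; apply/asboolP.
have [j Ej] : exists j, v j = i by exists (enum_rank_in iJ i); rewrite /v enum_rankK_in.
rewrite !(qdC x) -Ej; split.
  by have := hx (lshift _ j); rewrite /S (unsplitK (inl j : 'I_#|J| + 'I_#|J|)).
by have := hx (rshift _ j); rewrite /S (unsplitK (inr j : 'I_#|J| + 'I_#|J|)).
Qed.

Lemma refl_polygon_of : exists C' : 'I_n -> geodesic R * bool, refl L @` Q = polygon_of C'.
Proof.
have [i|C' hC'] := @half_planes_polygon_of n (fun i => refl L @` [set z | 0 <= side_eqn (C i) z]).
  by apply: refl_half_plane; apply/half_plane_side_eqn; exists (C i).
exists C'; rewrite hC' EQ; apply/seteqP; split=> [_ [z hz <-] i|z hz].
  by exists z => //; exact: hz.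
exists (refl L z); last exact: reflK.
by move=> i; have [y hy <-] := hz i; rewrite reflK.
Qed.

Lemma doubled_fundamental : fundamental_domain rotations doubled.
Proof.
split; [|exact: doubled_covers|exact: doubled_disjoint].
have [[_ [p Qp] fQ] _ _ _] := hG.
have [m [C2 E2]] := doubled_polygon_of; have [C' E'] := refl_polygon_of.
rewrite E2; apply: polygon_of_polygon.
  exists p; rewrite -E2; apply: filterS Qp => x; by left.
have fC : (harea (polygon_of C) < +oo)%E by rewrite -EQ.
have fC' : (harea (polygon_of C') < +oo)%E.
  apply: polygon_of_finite_area => H hH HC; apply: (polygon_of_no_half_plane fC (refl_half_plane L hH)).
  move=> _ [z Hz <-]; have := HC z Hz; rewrite -E' -EQ => -[y Qy <-].
  by rewrite reflK.
by apply: (harea_setU_fin fC fC'); rewrite -E2 -EQ -E'.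
Qed.

End Doubling.

Lemma refl_group_sides : exists n (C : 'I_n -> geodesic R * bool),
  [/\ Q = polygon_of C, forall i, bears_side Q (C i).1 &
    exists j z0 z1, [/\ z0 <> z1, geodesic_eqn (C j).1 z0 = 0,
      geodesic_eqn (C j).1 z1 = 0 &
      forall i, i != j -> 0 < side_eqn (C i) z0 /\ 0 < side_eqn (C i) z1]].
Proof.
have [pQ _ _ _] := hG; have [n [C [EQ sides]]] := polygon_sides pQ.
exists n, C; split=> // [i|].
  have [z0 [z1 [z01 e0 e1 hz]]] := sides i.
  by rewrite [in bears_side _ _]EQ; exact: (polygon_of_bears z01 e0 e1 hz).
(* Without sides [Q] would be the whole upper half-plane, which contains a half-disc and so has
   infinite area. *)
have [n0|n0] := posnP n; last by exists (Ordinal n0); exact: sides.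
exfalso; have [_ _ fQ] := pQ; rewrite EQ in fQ.
apply: (polygon_of_no_half_plane fQ (half_disc_half_plane (@ltr01 R))).
by move=> z _ [k hk]; exfalso; move: hk; rewrite n0.
Qed.

Lemma double_dirichlet_rotations : exists P, double_dirichlet_domain rotations P.
Proof.
have [n [C [EQ bC [j [z0 [z1 [z01 e0 e1 hz]]]]]]] := refl_group_sides.
have Q0 : Q z0.
  rewrite EQ => i; have [->|ij] := eqVneq i j; first by rewrite /side_eqn e0 mulr0.
  by apply: ltW; case: (hz i ij).
have Q1 : Q z1.
  rewrite EQ => i; have [->|ij] := eqVneq i j; first by rewrite /side_eqn e1 mulr0.
  by apply: ltW; case: (hz i ij).
have C0 i : (C i).1 = (C j).1 \/ 0 < side_eqn (C i) z0.
  by have [->|/hz []] := eqVneq i j; [left|right].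
have C1 i : (C i).1 = (C j).1 \/ 0 < side_eqn (C i) z1.
  by have [->|/hz []] := eqVneq i j; [left|right].
exists (doubled (C j).1); split.
  exact: (doubled_fundamental EQ bC (bC j) Q0 e0 C0).
exists z0, z1; split=> //.
  exact: (doubled_dirichlet EQ bC (bC j) Q0 e0 C0).
exact: (doubled_dirichlet EQ bC (bC j) Q1 e1 C1).
Qed.

End FundamentalDomain.

(** * Ideal vertices *)

Section Ford.
Variables (R : realType) (Q : set (uhp R)) (G : set (uhp R -> uhp R)).
Hypothesis hG : discrete_reflection_group Q G.
Implicit Types (z w p : uhp R) (f g h : uhp R -> uhp R).

Definition translation (s : R) z : uhp R := uhp_of (reh z + s) (imh_gt0 z).

Lemma translationD (s t : R) : translation s \o translation t = translation (t + s).
Proof. by apply/funext => z; apply: uhp_eq; rewrite //= addrA. Qed.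

Lemma translation0 : translation 0 = id.
Proof. by apply/funext => z; apply: uhp_eq; rewrite //= addr0. Qed.

Lemma translation_matrix (s : R) (A : 'M[R]_2) :
  A 0 0 = 1 -> A 0 1 = s -> A 1 0 = 0 -> A 1 1 = 1 -> preserving_matrix A (translation s).
Proof.
move=> e1 e2 e3 e4; apply/preserving_matrixP; rewrite e1 e2 e3 e4; split; first by ring.
by move=> z; rewrite /denom /=; split; field; rewrite ?oner_eq0.
Qed.

Lemma group_inverse (M : set (uhp R -> uhp R)) f g :
  is_group M -> M f -> g \o f = id -> M g.
Proof.
move=> [_ _ inv] /inv [h Mh [fh hf]] gf.
by have -> : g = h by rewrite -[g]/(g \o id) -fh compA gf.
Qed.

Lemma generated_translation (s : R) :
  generated [set translation s] = [set f | exists k : int, f = translation (k%:~R * s)].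
Proof.
apply/seteqP; split.
  apply: smallest_sub; last by move=> _ ->; exists 1; rewrite mul1r.
  split; first by exists 0; rewrite mul0r translation0.
    move=> _ _ [k ->] [l ->]; exists (l + k); rewrite translationD.
    by rewrite intrD mulrDl.
  move=> _ [k ->]; exists (translation ((- k)%:~R * s)); first by exists (- k).
  by rewrite !translationD -!mulrDl -!intrD subrr addNr mul0r translation0.
move=> _ [k ->] M [gM sM]; have Ms : M (translation s) by exact: sM.
have [Mid Mcomp _] := gM.
have nat_case (m : nat) : M (translation (m%:~R * s)).
  elim: m => [|m IH]; first by rewrite mul0r translation0.
  have -> : (m.+1%:~R * s) = m%:~R * s + s by rewrite intS intrD mulrDl mul1r addrC.
  by rewrite -translationD; exact: Mcomp.
case: k => m; first exact: nat_case.
apply: (group_inverse gM (nat_case m.+1)); rewrite translationD NegzE -mulrDl -intrD.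
by rewrite subrr mul0r translation0.
Qed.

Variables (x y : R).
Hypothesis xy : x < y.
Hypothesis bx : bears_side Q (Vertical x).
Hypothesis by_ : bears_side Q (Vertical y).
Hypothesis hx : forall M : R, exists2 z, (Q `&` line (Vertical x)) z & M < imh z.
Hypothesis hy : forall M : R, exists2 z, (Q `&` line (Vertical y)) z & M < imh z.

Lemma ideal_strip z : Q z -> x <= reh z <= y.
Proof.
move=> Qz; have [zx [Qzx /eqP + _]] := hx 0; have [zy [Qzy /eqP + _]] := hy 0.
rewrite /= !subr_eq0 => /eqP ey /eqP ex.
apply/andP; split.
  have [[] h _] := bx; first by have := h z Qz; rewrite /side_pos /= subr_ge0.
  by have := h zy Qzy; rewrite /side_neg /= ey subr_le0 leNgt xy.
have [[] h _] := by_; last by have := h z Qz; rewrite /side_neg /= subr_le0.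
by have := h zx Qzx; rewrite /side_pos /= ex subr_ge0 leNgt xy.
Qed.

(** Points of [Q] on [Re z = x] are arbitrarily high, so no half-disc contains [Q]; for a vertical
    side, one point of [Q] over [x] and one over [y] are tested. *)
Lemma ideal_side c : Q `<=` [set z | 0 <= side_eqn c z] ->
  (exists2 t, c.1 = Vertical t & 0 <= (-1) ^+ c.2 * (x - t) /\ 0 <= (-1) ^+ c.2 * (y - t)) \/
  (exists m r, c = (HalfCircle m r, false)).
Proof.
case: c => [[t|m r] s] H; [left|right].
  exists t => //; have [zx [Qzx /eqP + _]] := hx 0; have [zy [Qzy /eqP + _]] := hy 0.
  rewrite /= !subr_eq0 => /eqP ey /eqP ex.
  by have := H _ Qzx; have := H _ Qzy; rewrite /side_eqn /= ex ey.
exists m, r; congr pair; case: s H => // H; exfalso.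
have [z [Qz _] hz] := hx r%:num; have := H z Qz; rewrite /side_eqn /= expr1 mulN1r oppr_ge0.
have r0 : 0 < r%:num by [].
have := sqr_ge0 (reh z - m); nra.
Qed.

Lemma ideal_high c : Q `<=` [set z | 0 <= side_eqn c z] -> exists M : R, forall z, M < imh z ->
  [/\ x <= reh z <= y -> 0 <= side_eqn c z, x < reh z < y -> 0 < side_eqn c z
    & reh z = x -> c.1 = Vertical x \/ 0 < side_eqn c z].
Proof.
move=> /ideal_side [[t ct [h1 h2]]|[m [r ->]]].
  exists 0 => z _; rewrite /side_eqn ct /=; move: h1 h2.
  case: c.2; rewrite ?expr1 ?expr0 => h1 h2; split.
  - by move=> /andP[? ?]; lra.
  - by move=> /andP[? ?]; lra.
  - move=> ->; have [->|tx] := eqVneq t x; [by left|right].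
    by rewrite lt_def h1 andbT mulf_neq0 ?oppr_eq0 ?oner_eq0 // subr_eq0 eq_sym.
  - by move=> /andP[? ?]; lra.
  - by move=> /andP[? ?]; lra.
  move=> ->; have [->|tx] := eqVneq t x; [by left|right].
  by rewrite lt_def h1 andbT mulf_neq0 ?oner_eq0 // subr_eq0 eq_sym.
exists r%:num => z hz; have r0 : 0 < r%:num by [].
have pos : 0 < side_eqn (HalfCircle m r, false) z.
  by rewrite /side_eqn /= expr0 mul1r; have := sqr_ge0 (reh z - m); nra.
by split=> *; [exact: ltW|exact: pos|right].
Qed.

Variables (n : nat) (C : 'I_n -> geodesic R * bool).
Hypothesis EQ : Q = polygon_of C.
Hypothesis bC : forall i, bears_side Q (C i).1.

Let QC i : Q `<=` [set z | 0 <= side_eqn (C i) z].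
Proof. by move=> z; rewrite EQ; exact. Qed.

(** Vertical sides are decided by the real part alone and half-circles lie below their radius, so
    far enough up [Q] is the whole strip. *)
Lemma ideal_height : exists M : R, forall z, M < imh z ->
  [/\ x <= reh z <= y -> Q z, x < reh z < y -> Q° z
    & reh z = x -> forall i, (C i).1 = Vertical x \/ 0 < side_eqn (C i) z].
Proof.
have /choice [M hM] : forall i, exists M : R, forall z, M < imh z ->
  [/\ x <= reh z <= y -> 0 <= side_eqn (C i) z, x < reh z < y -> 0 < side_eqn (C i) z
    & reh z = x -> (C i).1 = Vertical x \/ 0 < side_eqn (C i) z].
  by move=> i; exact: ideal_high.
exists (\big[Num.max/0]_i M i) => z hz.
have hi i : M i < imh z by apply: le_lt_trans hz; exact: le_bigmax.
rewrite EQ; split.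
- by move=> xz i; case: (hM i z (hi i)) => + _ _; exact.
- by move=> xz; apply: polygon_of_interior => i; case: (hM i z (hi i)) => _ + _; exact.
- by move=> xz i; case: (hM i z (hi i)) => _ _; exact.
Qed.

Let Gx := refl_group_refl hG bx.
Let Gy := refl_group_refl hG by_.
(** The translation length of the product of the reflections in the two vertical sides. The mirror
    image [x0] of [y] in [x] is the left edge of the doubled strip, whose width is [t]. *)
Let t := 2 * (y - x).
Let x0 := 2 * x - y.
Let t0 : 0 < t. Proof. by have := xy; rewrite /t; lra. Qed.

Lemma translation_rotations (k : int) : rotations G (translation (k%:~R * t)).
Proof.
have gR := rotations_group hG.
have : generated [set translation t] `<=` rotations G.
  apply: smallest_sub => // _ ->.
  have -> : translation t = refl (Vertical y) \o refl (Vertical x).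
    by apply/funext => z; apply: uhp_eq; rewrite //= /t; ring.
  split; first exact: (refl_group_comp hG Gy Gx).
  have sN1 : (-1 : R) ^+ 2 = 1 by rewrite sqrrN expr1n.
  by have := mobius_comp sN1 sN1 (mobius_refl (Vertical y)) (mobius_refl (Vertical x)); rewrite mulrNN mulr1.
by apply; rewrite generated_translation; exists k.
Qed.

Lemma into_strip (u : R) : exists k : int, x0 <= u - k%:~R * t <= x0 + t.
Proof.
exists (Num.floor ((u - x0) / t)).
have := Num.Theory.floor_itv ((u - x0) / t).
rewrite intrD; set m : R := (Num.Def.floor _)%:~R.
rewrite ler_pdivlMr // ltr_pdivrMr // mulrDl mul1r => /andP[h1 h2].
by apply/andP; split; lra.
Qed.

Lemma strip_fold z : x0 <= reh z <= x0 + t ->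
  x <= reh z <= y \/ x <= reh (refl (Vertical x) z) <= y.
Proof.
rewrite /x0 /t /= => /andP[h1 h2]; have [h|h] := leP x (reh z); [left|right].
  by lra.
by apply/andP; split; lra.
Qed.

(** Such an [f] multiplies heights by [d^-2]. A point of the strip that is above [M] together with
    its image is returned by a translation to [Q] or its mirror image; the tessellation leaves only
    the identity and [refl (Vertical x)], the latter excluded by orientation. *)
Lemma stab_translation f : stab_infty (rotations G) f ->
  exists k : int, f = translation (k%:~R * t).
Proof.
move=> [[Gf hf] [A /preserving_matrixP [dA hA] A10]].
have [M hM] := ideal_height; rewrite A10 mulr0 subr0 in dA hA.
set a := A 0 0 in dA hA; set b := A 0 1 in hA; set d := A 1 1 in dA hA.
have d0 : d != 0 by apply/eqP => d0; move: dA; rewrite d0 mulr0 => /esym/eqP; rewrite oner_eq0.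
have d2 : 0 < d ^+ 2 by rewrite exprn_even_gt0.
(* Large enough that both [h] and the image height [h / d^2] exceed [M]. *)
pose h : R := 1 + `|M| + d ^+ 2 * `|M|.
have M0 := normr_ge0 M; have MM := ler_norm M.
have dM : 0 <= d ^+ 2 * `|M| by rewrite mulr_ge0 // ltW.
have h0 : 0 < h by rewrite /h; lra.
pose p := uhp_of ((x + y) / 2) h0.
have Qp : Q° p.
  have [|_ + _] := hM p; first by rewrite /= /h; lra.
  by have xy' := xy; apply; apply/andP; split; rewrite /=; lra.
have fp : M < imh (f p).
  have [_ ->] := hA p; rewrite /denom /= !mul0r add0r expr0n addr0 ltr_pdivlMr //.
  have : M * d ^+ 2 <= `|M| * d ^+ 2 by rewrite ler_pM2r.
  rewrite /h; lra.
have [k hk] := into_strip (reh (f p)).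
have [Gt hti] := translation_rotations (- k).
have s1 : (1 : R) ^+ 2 = 1 by rewrite expr1n.
set tr := translation ((- k)%:~R * t) in Gt hti.
have htf : mobius 1 (tr \o f) by have := mobius_comp s1 s1 hti hf; rewrite mulr1.
have Gtf := refl_group_comp hG Gt Gf.
have Ew : reh (tr (f p)) = reh (f p) - k%:~R * t by rewrite /= mulrNz mulNr.
have [Gid _ _] := refl_group_group hG.
exists k; suff E : tr \o f = id.
  have -> : f = translation (k%:~R * t) \o (tr \o f).
    by rewrite compA translationD mulrNz mulNr addNr translation0.
  by rewrite E.
rewrite -Ew in hk; have [sx|sx] := strip_fold hk.
  have Qw : Q (tr (f p)) by have [//|+ _ _] := hM (tr (f p)); exact.
  exact: (refl_group_eq_near hG Gtf Gid Qp Qw).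
have Qw : Q (refl (Vertical x) (tr (f p))).
  by have [//|+ _ _] := hM (refl (Vertical x) (tr (f p))); exact.
exfalso; apply: (mobius_sign htf).
have -> : tr \o f = refl (Vertical x).
  by apply: (refl_group_eq_near hG Gtf Gx Qp Qw); rewrite reflK.
exact: mobius_refl.
Qed.

Lemma stab_infty_rotations :
  stab_infty (rotations G) = generated [set translation t].
Proof.
rewrite generated_translation; apply/seteqP; split; first exact: stab_translation.
move=> _ [k ->]; split; first exact: translation_rotations.
have [A [e1 e2 e3 e4]] := mx2E 1 (k%:~R * t) 0 (1 : R).
by exists A => //; exact: translation_matrix.
Qed.

Lemma norm_denom (c d : R) z :
  `|c%:C * uval z + d%:C| = (Num.sqrt (denom c d z))%:C.
Proof.
rewrite normc_def; congr (Num.sqrt _)%:C; rewrite /denom.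
by case: z => [[u v] h] /=; ring.
Qed.

(** The imaginary part is divided by [|c z + d|^2], so lying on or outside the isometric circle
    means not being raised. *)
Lemma outside_imh f (A : 'M[R]_2) z : preserving_matrix A f ->
  (1 <= `|(A 1 0)%:C * uval z + (A 1 1)%:C|) = (imh (f z) <= imh z).
Proof.
move=> /preserving_matrixP [dA hA]; have [_ ->] := hA z.
have D0 : 0 < denom (A 1 0) (A 1 1) z.
  by apply: (@denom_gt0 _ (A 0 0) (A 0 1)); rewrite dA oner_eq0.
have zy := imh_gt0 z.
rewrite norm_denom lecR ler_pdivrMr // ler_pMr // -[in LHS](sqrtr1 R) ler_sqrt //.
exact: ltW.
Qed.

Let zh (s : R) (h : 0 < s) := uhp_of x h.

(* Compare the distances to [x + i s] and let [s] tend to infinity. *)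
Lemma doubled_imh z g : doubled Q (Vertical x) z -> G g -> imh (g z) <= imh z.
Proof.
move=> Pz Gg; have [g' [Gg' gg' g'g]] := refl_group_inv hG Gg.
have [M hM] := ideal_height; rewrite leNgt; apply/negP => lt.
set v := imh z in lt; set v' := imh (g z) in lt.
(* In the cleared inequality the terms linear in [s] cancel; it reads [(v' - v) s^2 <= K], which the
   choice of [s] below contradicts. *)
set K := v * ((reh (g z) - x) ^+ 2 + v' ^+ 2) - v' * ((reh z - x) ^+ 2 + v ^+ 2).
pose s : R := 1 + `|M| + `|K| / (v' - v).
have vv : 0 < v' - v by rewrite subr_gt0.
have K0 : 0 <= `|K| / (v' - v) by rewrite divr_ge0 // ltW.
have M0 := normr_ge0 M; have MM := ler_norm M.
have s0 : 0 < s by rewrite /s; lra.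
have hs : M < imh (zh s0) by rewrite /= /s; lra.
have [q1 _ q3] := hM _ hs.
have Qs : Q (zh s0) by apply: q1; rewrite /= lexx ltW.
have Ls : geodesic_eqn (Vertical x) (zh s0) = 0 by rewrite /= subrr.
have := doubled_closest hG bx Qs Ls Pz Gg'.
rewrite -[X in _ <= X](refl_group_qd hG _ _ Gg) -[g (g' _)]/((g \o g') _) gg' /=.
have v0 : 0 < v := imh_gt0 z; have v'0 : 0 < v' := imh_gt0 (g z).
rewrite /qd /= -/v -/v' ler_pdivrMr ?mulr_gt0 // mulrAC ler_pdivlMr ?mulr_gt0 //.
have -> : ((reh z - x) ^+ 2 + (v - s) ^+ 2) * (v' * s) =
   s * (v' * ((reh z - x) ^+ 2 + (v - s) ^+ 2)) by ring.
have -> : ((reh (g z) - x) ^+ 2 + (v' - s) ^+ 2) * (v * s) =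
   s * (v * ((reh (g z) - x) ^+ 2 + (v' - s) ^+ 2)) by ring.
rewrite ler_pM2l // => h.
have h1 : (v' - v) * s ^+ 2 <= K by rewrite /K; lra.
have KK := ler_norm K.
have : `|K| < (v' - v) * s.
  have -> : (v' - v) * s = (v' - v) * (1 + `|M|) + `|K| by rewrite /s; field; rewrite gt_eqF.
  by rewrite ltrDr mulr_gt0 //; lra.
have : (v' - v) * s <= (v' - v) * s ^+ 2.
  by rewrite ler_pM2l // expr2 ler_peMr ?(ltW s0) // /s; lra.
lra.
Qed.

(** Vertical sides are settled by the strip. Inversion in a half-circle multiplies the height by
    [r^2 / |w - m|^2], so not being raised by it means not lying inside. *)
Lemma strip_imh_polygon w : x <= reh w <= y -> (forall g, G g -> imh (g w) <= imh w) -> Q w.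
Proof.
move=> /andP[xw wy] H; rewrite EQ => i.
have [[s ct [h1 h2]]|[m [r E]]] := ideal_side (@QC i).
  rewrite /side_eqn ct /=; move: h1 h2; case: (C i).2; rewrite ?expr1 ?expr0; lra.
have := H _ (refl_group_refl hG (bC i)); rewrite /side_eqn E /= expr0 mul1r.
have D0 := sqrD_gt0 w m; have w0 := imh_gt0 w.
by rewrite ler_pdivrMr // mulrC ler_pM2l // subr_ge0.
Qed.

Lemma DF_rotations : exists P, DF_domain (rotations G) P.
Proof.
have [M hM] := ideal_height.
have M0 : 0 < 1 + `|M| by rewrite ltr_wpDr.
have hs : M < imh (zh M0) by rewrite /=; have := ler_norm M; lra.
have [q1 _ q3] := hM _ hs.
have Qs : Q (zh M0) by apply: q1; rewrite /= lexx ltW.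
have Ls : geodesic_eqn (Vertical x) (zh M0) = 0 by rewrite /= subrr.
have Cs : forall i, (C i).1 = Vertical x \/ 0 < side_eqn (C i) (zh M0) by exact: q3.
have [Gid Gcomp _] := refl_group_group hG.
exists (doubled Q (Vertical x)); split.
- exact: (doubled_fundamental hG EQ bC bx Qs Ls Cs).
- exists x0, t, (translation t); split=> //.
  + by move=> z; case: z => [[u v] h]; apply/eqP; rewrite eq_complex /= addr0 !eqxx.
  + exact: stab_infty_rotations.
  apply/seteqP; split=> z.
    move=> Pz; split.
      move=> A f [Gf _] _ pA; rewrite (outside_imh _ pA); exact: doubled_imh.
    rewrite /= /x0 /t; case: Pz => [/ideal_strip|[w /ideal_strip + <-]] /=;
      move=> /andP[? ?]; apply/andP; split; lra.
  move=> [out /strip_fold st].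
  (* Elements fixing infinity are translations, which preserve height; the others are controlled by
     their isometric circles. *)
  have rot f : rotations G f -> imh (f z) <= imh z.
    move=> rf; have [/stab_translation [k ->]//|ns] := pselect (stab_infty (rotations G) f).
    have [_ /mobius_preservingP [A pA]] := rf.
    by rewrite -(outside_imh _ pA); exact: (out A f).
  (* Reflection in a vertical line does not change heights, so reversing elements reduce to
     rotations. *)
  have all g : G g -> imh (g z) <= imh z.
    move=> Gg; case: (refl_group_isom hG Gg) => hg; first exact: rot.
    have := rot (refl (Vertical x) \o g); apply; split; first exact: Gcomp.
    have sN1 : (-1 : R) ^+ 2 = 1 by rewrite sqrrN expr1n.
    by have := mobius_comp sN1 sN1 (mobius_refl (Vertical x)) hg; rewrite mulrNN mulr1.
  case: st => hz; [left|right]; first exact: strip_imh_polygon.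
  exists (refl (Vertical x) z); last exact: reflK.
  apply: strip_imh_polygon => // g Gg.
  exact: (all (g \o refl (Vertical x)) (Gcomp _ _ Gg Gx)).
exists (zh M0); exact: (doubled_dirichlet hG EQ bC bx Qs Ls Cs).
Qed.

End Ford.

Theorem theorem5p4 (R : realType) (Q : set (uhp R)) (G : set (uhp R -> uhp R))
  (hG : discrete_reflection_group Q G) :
  exists Gamma : set (uhp R -> uhp R),
    [/\ fuchsian Gamma,
        index_two_subgroup Gamma G,
        exists P, double_dirichlet_domain Gamma P
      & ideal_vertex_at_infty Q -> exists P, DF_domain Gamma P].
Proof.
have [n [C [EQ bC [j _]]]] := refl_group_sides hG.
exists (rotations G); split.
- exact: rotations_fuchsian hG.
- exact: (index_two_rotations hG (bC j)).
- exact: double_dirichlet_rotations hG.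
move=> [x [y [xy ideal]]].
have [bx hx] := ideal x (or_introl erefl); have [by_ hy] := ideal y (or_intror erefl).
have [lt|lt|//] := ltgtP x y.
  exact: (DF_rotations hG lt bx by_ hx hy EQ bC).
exact: (DF_rotations hG lt by_ bx hy hx EQ bC).
Qed.
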